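(* Let $H$ be a subgroup of a group $G$. Then the following conditions are equivalent: (1) There exists an $H$-invariant state on $\ell^\infty(G\smallsetminus H)$ with respect to the conjugation action of $H$ on $G\smallsetminus H$, i.e. $H$ is inner amenable relative to $G$. (2) There exists a net $(\eta_n)$ of unit vectors in $\ell^1(G)^+$ such that $\mathrm{supp}(\eta_n)\subset G\smallsetminus H$ for every $n$, and $\lim_n\Vert\alpha(h)\eta_n-\eta_n\Vert_1=0$ for every $h\in H$. (3) There exists a net $(\xi_n)$ of unit vectors in $\ell^2(G)$ such that $\mathrm{supp}(\xi_n)\subset G\smallsetminus H$ for every $n$, and $\lim_n\Vert\alpha(h)\xi_n-\xi_n\Vert_2=0$ for every $h\in H$, i.e. the trivial representation $1_H$ is weakly contained in $\pi_{G\smallsetminus H}$. (4) There exists a net $(F_n)$ of non-empty finite subsets of $G\smallsetminus H$ such that $$\lim_n\frac{|F_n\bigtriangleup hF_nh^{-1}|}{|F_n|}=0$$ for every $h\in H$. (5) For every finite set $F\subset H$ and for every function $f:F\to[0,1]$ such that $\sum_{g\in F}f(g)=1$, the number $1$ belongs to the spectrum of $\alpha(f)(1-e_H)$. (6) There exists a state $\varphi$ on $B(\ell^2(G))$ such that $\varphi|_{C^*(\alpha(H))}=\tau|_{C^*(\alpha(H))}$ and $\varphi(e_H)=0$. In particular, $e_H\notin C^*(\alpha(H))$.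
   Context: Groups are discrete. $H$ is inner amenable relative to $G$ if $H$ is a proper subgroup of $G$ and there is a state on $\ell^\infty(G\smallsetminus H)$ invariant under the conjugation action of $H$ on $G\smallsetminus H$. $\alpha$ is the representation of $G$ on $\ell^2(G)$ by conjugation, $(\alpha(g)\xi)(g')=\xi(g^{-1}g'g)$; the same formula defines $\alpha(g)$ on $\ell^1(G)$. $\ell^1(G)^+$ is the cone of $\eta\in\ell^1(G)$ with $\eta(x)\ge 0$ for all $x$. $\mathrm{supp}$ denotes the set where a function is non-zero. $\pi_{G\smallsetminus H}$ is the unitary representation of $H$ on $\ell^2(G\smallsetminus H)$ associated with the conjugation action: $(\pi_{G\smallsetminus H}(h)\xi)(x)=\xi(h^{-1}xh)$. The trivial representation is weakly contained in a unitary representation $(\pi,\mathcal{H})$ of $H$ if there is a net of unit vectors $(\xi_n)\subset\mathcal{H}$ with $\Vert\pi(h)\xi_n-\xi_n\Vert\to 0$ for every $h\in H$. For $f:F\to[0,1]$ as in (5), $\alpha(f)=\sum_{g\in F}f(g)\alpha(g)\in B(\ell^2(G))$. $e_H\in B(\ell^2(G))$ is the orthogonal projection onto $\ell^2(H)$, i.e. multiplication by the characteristic function of $H$. $C^*(\alpha(H))$ is the C$^*$-algebra generated by $\alpha(H)$ in $B(\ell^2(G))$. $\tau$ denotes the state on $B(\ell^2(G))$ given by $\tau(x)=\langle x\delta_1|\delta_1\rangle$, where $(\delta_g)_{g\in G}$ is the canonical basis of $\ell^2(G)$. *)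

(* Defs.v *)
From HB Require Import structures.
From mathcomp Require Import all_boot all_order all_algebra finmap.
From mathcomp Require Import complex.
From mathcomp Require Import all_classical all_reals.
From mathcomp Require Import ereal topology normedtype esum.
From mathcomp Require Import ring lra.

Set Implicit Arguments.
Unset Strict Implicit.
Unset Printing Implicit Defensive.

Import Order.TTheory GRing.Theory Num.Theory.
Import Normc.
Import numFieldNormedType.Exports.

Local Open Scope classical_set_scope.
Local Open Scope ring_scope.

(** * Nets *)

Definition directed (I : Type) (le : I -> I -> Prop) : Prop :=
  [/\ inhabited I,
      forall i, le i i,
      forall i j k, le i j -> le j k -> le i k &
      forall i j, exists k, le i k /\ le j k].

(* A net [x : I -> T] over [(I, le)] converges to [l] when
   [x @ tails le --> l]. *)
Definition tails (I : Type) (le : I -> I -> Prop) : set_system I :=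
  filter_from setT (fun i => [set j | le i j]).

(** * Unordered sums *)

Section Sums.
Variables (R : realType) (X : choiceType).
Implicit Types (u v w : X -> R).

(* Sum in [[0, +oo]] of a family of nonnegative reals. *)
Definition nnsum u : \bar R := \esum_(x in [set: X]) (u x)%:E.

(* Sum of an absolutely summable real family (junk value otherwise). *)
Definition rsum u : R :=
  fine (nnsum (fun x => Num.max (u x) 0))
  - fine (nnsum (fun x => Num.max (- u x) 0)).

(* Sum of an absolutely summable complex family (junk value otherwise). *)
Definition csum (f : X -> R[i]) : R[i] :=
  Complex (rsum (fun x => complex.Re (f x))) (rsum (fun x => complex.Im (f x))).

Lemma nnsum_ge0 u : (forall x, 0 <= u x) -> (0 <= nnsum u)%E.
Proof. by move=> u0; apply: esum_ge0 => x _; rewrite lee_fin. Qed.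

Lemma nnsum_fin u : (forall x, 0 <= u x) -> (nnsum u < +oo)%E ->
  nnsum u \is a fin_num.
Proof. by move=> u0 uoo; rewrite ge0_fin_numE// nnsum_ge0. Qed.

Lemma nnsum_scale (a : R) u : 0 <= a -> (forall x, 0 <= u x) ->
  (nnsum (fun x => a * u x)%R <= a%:E * nnsum u)%E.
Proof.
move=> a0 u0; rewrite /nnsum ge_ereal_sup//= => _ [A [finA _]] <-.
under eq_fsbigr do rewrite EFinM.
rewrite -ge0_mule_fsumr; last by move=> x; rewrite lee_fin.
by rewrite lee_wpmul2l ?lee_fin//; apply: esum_ge; exists A.
Qed.

Lemma nnsum_dom (a b : R) u v w :
  0 <= a -> 0 <= b -> (forall x, 0 <= u x) -> (forall x, 0 <= v x) ->
  (forall x, w x <= a * u x + b * v x) ->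
  (nnsum w <= a%:E * nnsum u + b%:E * nnsum v)%E.
Proof.
move=> a0 b0 u0 v0 wle.
apply: (@le_trans _ _ (nnsum (fun x => a * u x)%R + nnsum (fun x => b * v x)%R)).
  rewrite /nnsum -esumD; [|by move=> x _; rewrite lee_fin mulr_ge0..].
  by apply: le_esum => x _; rewrite -EFinD lee_fin.
by rewrite leeD// nnsum_scale.
Qed.

Lemma nnsum_lty (a b : R) u v w :
  0 <= a -> 0 <= b -> (forall x, 0 <= u x) -> (forall x, 0 <= v x) ->
  (forall x, w x <= a * u x + b * v x) ->
  (nnsum u < +oo)%E -> (nnsum v < +oo)%E -> (nnsum w < +oo)%E.
Proof.
move=> a0 b0 u0 v0 wle uoo voo; apply: le_lt_trans (nnsum_dom a0 b0 u0 v0 wle) _.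
have /fineK <- := nnsum_fin u0 uoo; have /fineK <- := nnsum_fin v0 voo.
by rewrite -!EFinM -EFinD ltry.
Qed.

Lemma nnsum_inj (s : X -> X) u : injective s -> (forall x, 0 <= u x) ->
  (nnsum (u \o s) <= nnsum u)%E.
Proof.
move=> sI u0; rewrite /nnsum.
rewrite -(@esum_image _ _ _ setT s (EFin \o u)); last by move=> x y _ _ /sI.
by apply: ereal_sup_le => _ [A [finA _] <-]; exists A.
Qed.

Lemma nnsum0 : nnsum (fun=> 0) = 0%E.
Proof. exact: esum1. Qed.

End Sums.

Lemma normc_ge0 (R : rcfType) (z : R[i]) : 0 <= normc z.
Proof. by case: z => a b; exact: sqrtr_ge0. Qed.

Lemma normc_lin (R : rcfType) (a z w : R[i]) :
  normc (a * z + w) <= normc a * normc z + normc w.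
Proof. by rewrite -normcM; exact: le_normcD. Qed.

Lemma normc_lin2 (R : rcfType) (a z w : R[i]) :
  normc (a * z + w) ^+ 2 <= (2 * normc a ^+ 2) * normc z ^+ 2 + 2 * normc w ^+ 2.
Proof.
apply: (@le_trans _ _ ((normc a * normc z + normc w) ^+ 2)).
  by rewrite lerXn2r ?nnegrE ?addr_ge0 ?mulr_ge0 ?normc_ge0// normc_lin.
by have := sqr_ge0 (normc a * normc z - normc w); nra.
Qed.

(** * The Banach spaces [l^1(X)], [l^2(X)] and [l^oo(X)] *)

Section Ell1.
Variables (R : realType) (X : choiceType).

Definition is_ell1 : {pred X -> R[i]} :=
  fun f => (nnsum (fun x => normc (f x)) < +oo)%E.

Lemma is_ell1_submod : submod_closed is_ell1.
Proof.
split=> [|a f g]; rewrite !unfold_in.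
  rewrite (_ : (fun x => _) = fun=> 0) ?nnsum0 ?ltry//.
  by apply/funext => x; rewrite normc0.
apply: (@nnsum_lty _ _ (normc a) 1); rewrite ?normc_ge0// => x; rewrite ?normc_ge0//.
by rewrite mul1r normc_lin.
Qed.

HB.instance Definition _ := GRing.isSubmodClosed.Build R[i] (X -> R[i]) is_ell1
  (GRing.submod_closed_semi is_ell1_submod).

Record ell1 := Ell1 { ell1_fun :> X -> R[i]; _ : ell1_fun \in is_ell1 }.
HB.instance Definition _ := [isSub for ell1_fun].
HB.instance Definition _ := [Choice of ell1 by <:].
HB.instance Definition _ := [SubChoice_isSubLmodule of ell1 by <:].

Definition norm1 (f : ell1) : R := fine (nnsum (fun x => normc (f x))).

Lemma comp_ell1_subproof (s : X -> X) (f : ell1) :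
  injective s -> (f \o s) \in is_ell1.
Proof.
move=> sI; have := valP f; rewrite !unfold_in; apply: le_lt_trans.
by apply: (@nnsum_inj _ _ s (fun x => normc (f x))) => // x; exact: normc_ge0.
Qed.

Definition comp_ell1 (s : X -> X) (sI : injective s) (f : ell1) : ell1 :=
  Ell1 (comp_ell1_subproof f sI).

End Ell1.

Section Ell2.
Variables (R : realType) (X : choiceType).

Definition is_ell2 : {pred X -> R[i]} :=
  fun f => (nnsum (fun x => (normc (f x) ^+ 2)%R) < +oo)%E.

Lemma is_ell2_submod : submod_closed is_ell2.
Proof.
split=> [|a f g]; rewrite !unfold_in.
  rewrite (_ : (fun x => _) = fun=> 0) ?nnsum0 ?ltry//.
  by apply/funext => x; rewrite normc0 expr0n.
apply: (@nnsum_lty _ _ (2 * normc a ^+ 2) 2) => // [|x|x|x]; rewrite ?sqr_ge0//.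
  by rewrite mulr_ge0// sqr_ge0.
exact: normc_lin2.
Qed.

HB.instance Definition _ := GRing.isSubmodClosed.Build R[i] (X -> R[i]) is_ell2
  (GRing.submod_closed_semi is_ell2_submod).

Record ell2 := Ell2 { ell2_fun :> X -> R[i]; _ : ell2_fun \in is_ell2 }.
HB.instance Definition _ := [isSub for ell2_fun].
HB.instance Definition _ := [Choice of ell2 by <:].
HB.instance Definition _ := [SubChoice_isSubLmodule of ell2 by <:].

Definition norm2 (f : ell2) : R :=
  Num.sqrt (fine (nnsum (fun x => normc (f x) ^+ 2))).

(* Linear in the first variable. *)
Definition dotp (f g : ell2) : R[i] := csum (fun x => f x * (g x)^*%C).

Lemma delta_subproof (a : X) : (fun x => (x == a)%:R) \in is_ell2.
Proof.
rewrite unfold_in /nnsum (esumID [set a]); last first.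
  by move=> x _; rewrite lee_fin sqr_ge0.
rewrite !setTI esum_set1 ?lee_fin ?sqr_ge0// esum1 ?adde0 ?ltry// => x /= xa.
by case: eqP => // _; rewrite normc0 expr0n.
Qed.

Definition delta (a : X) : ell2 := Ell2 (delta_subproof a).

Lemma norm2_ge0 (f : ell2) : 0 <= norm2 f.
Proof. exact: sqrtr_ge0. Qed.

Lemma sqr_norm2 (f : ell2) :
  ((norm2 f ^+ 2)%R%:E = nnsum (fun x => (normc (f x) ^+ 2)%R))%E.
Proof.
have f0 x : 0 <= normc (f x) ^+ 2 by exact: sqr_ge0.
rewrite sqr_sqrtr ?fine_ge0 ?nnsum_ge0// fineK// nnsum_fin//.
by have := valP f; rewrite unfold_in.
Qed.

Lemma norm2_lin (a : R[i]) (f g : ell2) :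
  norm2 (a *: f + g) <= 2 * (normc a * norm2 f + norm2 g).
Proof.
have na := normc_ge0 a; have nf := norm2_ge0 f; have ng := norm2_ge0 g.
have H : norm2 (a *: f + g) ^+ 2
    <= (2 * normc a ^+ 2) * norm2 f ^+ 2 + 2 * norm2 g ^+ 2.
  rewrite -lee_fin EFinD !(EFinM _ (_ ^+ 2)) !sqr_norm2.
  apply: nnsum_dom => // [|x|x|x]; rewrite ?sqr_ge0// ?mulr_ge0 ?sqr_ge0//.
  exact: normc_lin2.
rewrite -(@ler_pXn2r _ 2)// ?nnegrE ?norm2_ge0//; last first.
  by rewrite mulr_ge0// addr_ge0// mulr_ge0.
apply: le_trans H _; have := mulr_ge0 na nf; set p := _ * norm2 f => p0.
rewrite -mulrA -exprMn -/p; nra.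
Qed.

Lemma norm20 : norm2 0 = 0.
Proof.
rewrite /norm2 (_ : (fun x => _) = fun=> 0) ?nnsum0 ?sqrtr0//.
by apply/funext => x; rewrite (_ : (0 : ell2) x = 0)// normc0 expr0n.
Qed.

End Ell2.

Section EllInf.
Variables (R : realType) (X : choiceType).

Definition is_ellinf : {pred X -> R[i]} :=
  fun f => `[< exists M : R, forall x, normc (f x) <= M >].

Lemma is_ellinf_submod : submod_closed is_ellinf.
Proof.
split=> [|a f g]; rewrite !unfold_in.
  by apply/asboolP; exists 0 => x; rewrite normc0.
move=> /asboolP[M fM] /asboolP[N gN]; apply/asboolP.
exists (normc a * M + N) => x; apply: le_trans (normc_lin _ _ _) _.
by rewrite lerD// ler_wpM2l ?normc_ge0.
Qed.

HB.instance Definition _ := GRing.isSubmodClosed.Build R[i] (X -> R[i])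
  is_ellinf (GRing.submod_closed_semi is_ellinf_submod).

Record ellinf := EllInf { ellinf_fun :> X -> R[i]; _ : ellinf_fun \in is_ellinf }.
HB.instance Definition _ := [isSub for ellinf_fun].
HB.instance Definition _ := [Choice of ellinf by <:].
HB.instance Definition _ := [SubChoice_isSubLmodule of ellinf by <:].

Lemma one_ellinf_subproof : (fun=> 1) \in is_ellinf.
Proof. by rewrite unfold_in; apply/asboolP; exists 1 => x; rewrite normc1. Qed.

Definition one_ellinf : ellinf := EllInf one_ellinf_subproof.

Lemma comp_ellinf_subproof (s : X -> X) (f : ellinf) : (f \o s) \in is_ellinf.
Proof.
have := valP f; rewrite !unfold_in => /asboolP[M fM]; apply/asboolP.
by exists M => x; exact: fM.
Qed.

Definition comp_ellinf (s : X -> X) (f : ellinf) : ellinf :=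
  EllInf (comp_ellinf_subproof s f).

(* In [R[i]], [0 <= z] means that [z] is a nonnegative real. *)
Definition ellinf_state (phi : {linear ellinf -> R[i]}) : Prop :=
  (forall f : ellinf, (forall x, 0 <= f x) -> 0 <= phi f)
  /\ phi one_ellinf = 1.

End EllInf.

(** * Bounded operators on [l^2(X)] *)

Section Bop.
Variables (R : realType) (X : choiceType).
Local Notation ell2 := (ell2 R X).

Definition is_bop : {pred ell2 -> ell2} := fun T =>
  `[< linear T /\ exists M : R, forall f, norm2 (T f) <= M * norm2 f >].

Lemma is_bop_submod : submod_closed is_bop.
Proof.
split=> [|a S T]; rewrite !unfold_in.
  apply/asboolP; split=> [c f g|]; first by rewrite /= scaler0 addr0.
  by exists 0 => f; rewrite mul0r norm20.
move=> /asboolP[Slin [M SM]] /asboolP[Tlin [N TN]]; apply/asboolP; split.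
  move=> c f g; rewrite !fctE Slin Tlin !scalerDr !scalerA (mulrC a c).
  by rewrite addrACA.
exists (2 * (normc a * M + N)) => f; rewrite !fctE.
apply: le_trans (norm2_lin _ _ _) _.
rewrite -mulrA ler_pM2l// mulrDl -mulrA lerD//.
by rewrite ler_wpM2l// normc_ge0.
Qed.

HB.instance Definition _ := GRing.isSubmodClosed.Build R[i] (ell2 -> ell2)
  is_bop (GRing.submod_closed_semi is_bop_submod).

(* [bop] is the algebra B(l^2(X)). It is only given a ring and a module
   structure, as mathcomp's [algType] requires 1 != 0, i.e. X non-empty. *)
Record bop := Bop { bop_fun :> ell2 -> ell2; _ : bop_fun \in is_bop }.
HB.instance Definition _ := [isSub for bop_fun].
HB.instance Definition _ := [Choice of bop by <:].
HB.instance Definition _ := [SubChoice_isSubLmodule of bop by <:].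

Lemma bopP (T : bop) :
  linear T /\ exists M : R, forall f, norm2 (T f) <= M * norm2 f.
Proof. by have := valP T; rewrite unfold_in => /asboolP. Qed.

Lemma bop_one_subproof : id \in is_bop.
Proof.
by rewrite unfold_in; apply/asboolP; split=> //; exists 1 => f; rewrite mul1r.
Qed.

Definition bop_one : bop := Bop bop_one_subproof.

Lemma bop_mul_subproof (S T : bop) : (S \o T) \in is_bop.
Proof.
have [Sl [M SM]] := bopP S; have [Tl [N TN]] := bopP T.
rewrite unfold_in; apply/asboolP; split=> [a f g|]; first by rewrite /= Tl Sl.
exists (`|M| * `|N|) => f /=; apply: le_trans (SM _) _.
apply: (@le_trans _ _ (`|M| * norm2 (T f))).
  by rewrite ler_wpM2r ?norm2_ge0// ler_norm.
rewrite -mulrA ler_wpM2l//; apply: le_trans (TN _) _.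
by rewrite ler_wpM2r ?norm2_ge0// ler_norm.
Qed.

Definition bop_mul (S T : bop) : bop := Bop (bop_mul_subproof S T).

Lemma bop_mulA : associative bop_mul.
Proof. by move=> S T U; apply/val_inj. Qed.
Lemma bop_mul1 : left_id bop_one bop_mul.
Proof. by move=> S; apply/val_inj. Qed.
Lemma bop_mulr1 : right_id bop_one bop_mul.
Proof. by move=> S; apply/val_inj. Qed.
Lemma bop_mulDl : left_distributive bop_mul +%R.
Proof. by move=> S T U; apply/val_inj. Qed.
Lemma bop_mulDr : right_distributive bop_mul +%R.
Proof.
move=> S T U; apply/val_inj/funext => f /=.
have [Sl _] := bopP S; rewrite !fctE.
by have := Sl 1 (T f) (U f); rewrite !scale1r.
Qed.

HB.instance Definition _ := GRing.Zmodule_isPzRing.Build bop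
  bop_mulA bop_mul1 bop_mulr1 bop_mulDl bop_mulDr.

Definition opnorm (T : bop) : R := sup [set norm2 (T f) | f in [set f | norm2 f <= 1]].

Definition is_adjoint (T T' : bop) : Prop :=
  forall f g, dotp (T f) g = dotp f (T' g).

Definition bop_positive (T : bop) : Prop :=
  exists S S' : bop, is_adjoint S S' /\ T = S' * S.

Definition bop_state (phi : {linear bop -> R[i]}) : Prop :=
  (forall T, bop_positive T -> 0 <= phi T) /\ phi 1 = 1.

Definition spectrum (T : bop) : set R[i] :=
  [set l : R[i] | ~ exists S : bop,
     S * (l *: (1 : bop) - T) = 1 /\ (l *: (1 : bop) - T) * S = 1].

Definition Cstar_subalgebra (A : set bop) : Prop :=
  [/\ A 0,
      forall (a : R[i]) S T, A S -> A T -> A (a *: S + T),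
      forall S T, A S -> A T -> A (S * T),
      forall T T', A T -> is_adjoint T T' -> A T' &
      forall T, (forall e : R, 0 < e -> exists2 S, A S & opnorm (T - S) < e) ->
        A T].

Definition Cstar_generated (S : set bop) : set bop :=
  \bigcap_(A in [set A | Cstar_subalgebra A /\ S `<=` A]) A.

Lemma comp_bop_subproof1 (s : X -> X) (f : ell2) :
  injective s -> (f \o s) \in @is_ell2 R X.
Proof.
move=> sI; have := valP f; rewrite !unfold_in; apply: le_lt_trans.
by apply: (@nnsum_inj _ _ s (fun x => normc (f x) ^+ 2)) => // x; exact: sqr_ge0.
Qed.

Lemma comp_bop_subproof2 (s : X -> X) (sI : injective s) :
  (fun f => Ell2 (comp_bop_subproof1 f sI)) \in is_bop.
Proof.
rewrite unfold_in; apply/asboolP; split=> [a f g|]; first exact/val_inj.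
exists 1 => f; rewrite mul1r -(@ler_pXn2r _ 2)// ?nnegrE ?norm2_ge0//.
rewrite -lee_fin !sqr_norm2 /=.
by apply: (@nnsum_inj _ _ s (fun x => normc (f x) ^+ 2)) => // x; exact: sqr_ge0.
Qed.

(* The operator [f |-> f \o s]. *)
Definition comp_bop (s : X -> X) (sI : injective s) : bop :=
  Bop (comp_bop_subproof2 sI).

Section Projection.
Variable P : {pred X}.

Let restr (f : X -> R[i]) : X -> R[i] := fun x => if x \in P then f x else 0.

Let restr_le f x : normc (restr f x) ^+ 2 <= normc (f x) ^+ 2.
Proof. by rewrite /restr; case: ifP => //; rewrite normc0 expr0n sqr_ge0. Qed.

Lemma proj_bop_subproof1 (f : ell2) :
  (fun x => if x \in P then f x else 0) \in @is_ell2 R X.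
Proof.
have := valP f; rewrite !unfold_in; apply: le_lt_trans.
by apply: le_esum => x _; rewrite lee_fin; exact: restr_le.
Qed.

Lemma proj_bop_subproof2 : (fun f => Ell2 (proj_bop_subproof1 f)) \in is_bop.
Proof.
rewrite unfold_in; apply/asboolP; split=> [a f g|].
  apply/val_inj/funext => x /=; rewrite !fctE /=.
  by case: ifP => // _; rewrite scaler0 addr0.
exists 1 => f; rewrite mul1r -(@ler_pXn2r _ 2)// ?nnegrE ?norm2_ge0//.
rewrite -lee_fin !sqr_norm2 /=.
by apply: le_esum => x _; rewrite lee_fin; exact: restr_le.
Qed.

(* Multiplication by the characteristic function of [P]. *)
Definition proj_bop : bop := Bop proj_bop_subproof2.

End Projection.

End Bop.

(** * Conjugation *)

Section Subgroup.
Variables (G : groupType) (H : groupClosed G).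

Definition subgroup : Type := {x : G | x \in H}.
HB.instance Definition _ := SubChoice.on subgroup.
Lemma subgroup_closed : group_closed H.
Proof. by split; [exact: gpred1 | exact: gpredF]. Qed.
HB.instance Definition _ :=
  SubChoice_isSubGroup.Build G (mem H) subgroup subgroup_closed.

(* G \ H *)
Definition complement : choiceType := {x : G | x \notin H}.

Definition conj_by (g x : G) : G := (g^-1 * x * g)%g.

Lemma conj_by_inj (g : G) : injective (conj_by g).
Proof. by move=> x y /mulIg /mulgI. Qed.

Lemma conj_compl_subproof (h : subgroup) (x : complement) :
  conj_by (val h) (val x) \notin H.
Proof.
by rewrite /conj_by gpredMr ?(valP h)// gpredMl ?gpredV ?(valP h)// (valP x).
Qed.

Definition conj_compl (h : subgroup) (x : complement) : complement :=
  exist _ (conj_by (val h) (val x)) (conj_compl_subproof h x).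

Lemma conj_compl_inj (h : subgroup) : injective (conj_compl h).
Proof. by move=> x y /(congr1 val) /= /conj_by_inj /val_inj. Qed.

End Subgroup.

Section ConjugationRepresentation.
Variables (R : realType) (G : groupType).

Definition alpha (g : G) : bop R G := comp_bop R (@conj_by_inj G g).

Definition alpha1 (g : G) : ell1 R G -> ell1 R G := comp_ell1 (@conj_by_inj G g).

Lemma alphaE (g : G) (f : ell2 R G) (x : G) :
  alpha g f x = f (g^-1 * x * g)%g.
Proof. by []. Qed.

Lemma alpha1E (g : G) (f : ell1 R G) (x : G) :
  alpha1 g f x = f (g^-1 * x * g)%g.
Proof. by []. Qed.

Definition alpha_avg (F : {fset G}) (f : F -> R) : bop R G :=
  \sum_(g : F) (f g)%:C%C *: alpha (val g).

Definition tau (T : bop R G) : R[i] := dotp (T (delta R 1%g)) (delta R 1%g).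

Variable H : groupClosed G.

Definition eproj : bop R G := proj_bop R (mem H).

Definition pi_compl (h : subgroup H) : bop R (complement H) :=
  comp_bop R (@conj_compl_inj G H h).

Definition Cstar_alpha : set (bop R G) :=
  Cstar_generated [set alpha h | h in [set h | h \in H]].

Definition invariant_state (phi : {linear ellinf R (complement H) -> R[i]}) :
    Prop :=
  ellinf_state phi /\
  forall (h : subgroup H) f, phi (comp_ellinf (conj_compl h) f) = phi f.

Definition inner_amenable_relative : Prop :=
  (exists g : G, g \notin H) /\ exists phi, invariant_state phi.

Lemma pi_complE (h : subgroup H) (f : ell2 R (complement H)) x :
  pi_compl h f x = f (conj_compl h x).
Proof. by []. Qed.

End ConjugationRepresentation.

Arguments alpha R {G} g.
Arguments eproj R {G} H.
Arguments pi_compl R {G} H h.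
Arguments Cstar_alpha R {G} H.
Arguments inner_amenable_relative R {G} H.

(* Weak containment of the trivial representation of [K] in a unitary
   representation [pi] of [K] on a Hilbert space of the form l^2(X). *)
Definition weakly_contains_trivial (R : realType) (K : groupType)
    (X : choiceType) (pi : K -> bop R X) : Prop :=
  exists (I : Type) (le : I -> I -> Prop) (xi : I -> ell2 R X),
    [/\ directed le, forall n, norm2 (xi n) = 1 &
        forall k : K,
          (fun n => norm2 (pi k (xi n) - xi n)) @ tails le --> (0 : R)].

Definition conj_fset (G : groupType) (h : G) (F : {fset G}) : {fset G} :=
  [fset (h * x * h^-1)%g | x in F]%fset.

Definition fsymdiff (K : choiceType) (A B : {fset K}) : {fset K} :=
  ((A `\` B) `|` (B `\` A))%fset.

(* Main.v *)
From HB Require Import structures.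
Require Import Defs.
From mathcomp Require Import all_boot all_order all_algebra finmap.
From mathcomp Require Import complex.
From mathcomp Require Import all_classical all_reals.
From mathcomp Require Import ereal topology normedtype esum.
From mathcomp Require Import sequences.
From mathcomp Require Import ring lra.

Set Implicit Arguments.
Unset Strict Implicit.
Unset Printing Implicit Defensive.

Import Order.TTheory GRing.Theory Num.Theory.
Import Normc.
Import numFieldNormedType.Exports.

Local Open Scope classical_set_scope.
Local Open Scope ring_scope.

(** Each condition asks for objects on [G \ H] that are almost invariant under
    conjugation by [H]. For the conditions stated with nets this is first put in
    finitary form, [approximable]: for every finite subset of [H] and every
    tolerance there is one object displaced by less than the tolerance.

    From an invariant state on [l^oo(G \ H)] one gets almost invariant densities
    by Day's argument ([invariant_state_density]): if the displacements of the
    densities stayed away from 0, the Hahn-Banach theorem would separate them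
    from 0 by finitely many bounded functions, whose total displacement would be
    bounded below by a positive constant; but an invariant state gives this total
    displacement the value 0. Square roots turn densities into unit vectors of
    [l^2], and squares turn vectors into densities. From a density one gets a
    finite set by decomposing it into its level sets ([level_set]): the
    displacement of the density is the weighted sum of those of its level sets,
    so some level set is displaced proportionally as little.

    The indicator of an almost invariant set is almost fixed by every average
    [alpha f], so [1 - alpha f (1 - e_H)] has no bounded inverse. Conversely, if
    [H] had no almost invariant unit vector off [H] for some finite subset and
    some tolerance, then by uniform convexity ([norm2_mean_gap]) the uniform
    average over this subset and 1 would be a strict contraction off [H], and the
    Neumann series ([neumann_inverse]) would remove 1 from the spectrum.

    A limit of vector states along almost invariant vectors supported off [H]
    vanishes at [e_H]. It extends [tau] because [delta 1] is itself invariant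
    under conjugation, and because every operator of [C*(alpha H)] acts on
    sufficiently invariant vectors almost as a scalar, which is then read off at
    [delta 1] ([asymptotic_eigen_Cstar]). Conversely, a state [phi] as in the last
    condition restricts to a state on [l^oo(G \ H)], viewed as an algebra of
    multiplication operators, because [phi e_H = 0]. Since [phi (alpha h) = 1],
    the operator [alpha h - 1] is a null vector for [phi], whence
    [phi (alpha h T) = phi T = phi (T alpha h)], and this restriction is invariant
    ([invariant_state_of_bop_state]). *)

(** * Unordered sums *)

Section RealSums.
Variables (R : realType) (X : choiceType).
Implicit Types (u v a b : X -> R).

Definition abs_summable u : Prop := (nnsum (fun x => `|u x|%R) < +oo)%E.

Lemma le_nnsum u v : (forall x, u x <= v x) -> (nnsum u <= nnsum v)%E.
Proof. by move=> uv; apply: le_esum => x _; rewrite lee_fin. Qed.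

Lemma nnsumD u v : (forall x, 0 <= u x) -> (forall x, 0 <= v x) ->
  (nnsum (fun x => u x + v x)%R = nnsum u + nnsum v)%E.
Proof.
move=> u0 v0; rewrite /nnsum -esumD; [|by move=> x _; rewrite lee_fin..].
by apply: eq_esum => x _; rewrite EFinD.
Qed.

Lemma nnsumZ (c : R) u : 0 <= c -> (forall x, 0 <= u x) ->
  (nnsum (fun x => c * u x)%R = c%:E * nnsum u)%E.
Proof.
move=> c0 u0; apply/eqP; rewrite eq_le nnsum_scale//=.
have [->|c_neq0] := eqVneq c 0.
  by rewrite mul0e nnsum_ge0// => x; rewrite mul0r.
have {c_neq0}c0 : 0 < c by rewrite lt_def c_neq0.
rewrite -lee_pdivlMl//.
apply: le_trans (nnsum_scale _ _); last 2 first.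
- by rewrite invr_ge0 ltW.
- by move=> x; rewrite mulr_ge0// ltW.
by apply: le_nnsum => x; rewrite mulKf ?gt_eqF.
Qed.

Lemma nnsum_summable u : (forall x, 0 <= u x) ->
  abs_summable u <-> (nnsum u < +oo)%E.
Proof. by move=> u0; rewrite /abs_summable; under eq_fun do rewrite ger0_norm//. Qed.

Lemma abs_summable_dom (c d : R) u v w : 0 <= c -> 0 <= d ->
    (forall x, `|w x| <= c * `|u x| + d * `|v x|) ->
  abs_summable u -> abs_summable v -> abs_summable w.
Proof. by move=> c0 d0 wle; apply: (@nnsum_lty _ _ c d) => // x. Qed.

Lemma abs_summableZ (c : R) u : abs_summable u -> abs_summable (fun x => c * u x).
Proof.
move=> us; apply: (@abs_summable_dom `|c| 0 u u) => // x.
by rewrite normrM mul0r addr0.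
Qed.

Let pos u x := Num.max (u x) 0.
Let neg u x := Num.max (- u x) 0.

Let pos_ge0 u x : 0 <= pos u x. Proof. by rewrite le_max lexx orbT. Qed.
Let neg_ge0 u x : 0 <= neg u x. Proof. by rewrite le_max lexx orbT. Qed.

Let posBneg u x : u x = pos u x - neg u x.
Proof. by rewrite /pos /neg; case: (leP (u x) 0); case: (leP (- u x) 0); lra. Qed.

Let pos_fin u : abs_summable u -> nnsum (pos u) \is a fin_num.
Proof.
move=> us; apply: nnsum_fin => //; apply: le_lt_trans us; apply: le_nnsum => x.
by rewrite /pos ge_max normr_ge0 ler_norm.
Qed.

Let neg_fin u : abs_summable u -> nnsum (neg u) \is a fin_num.
Proof.
move=> us; apply: nnsum_fin => //; apply: le_lt_trans us; apply: le_nnsum => x.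
by rewrite /neg ge_max normr_ge0 -normrN ler_norm.
Qed.

(** The algebraic rules for [rsum] follow from this one: the sum of a difference
    does not depend on the chosen decomposition, because
    [u^+ + b = u^- + a] can be summed as an identity of nonnegative families. *)
Lemma rsumB a b : (forall x, 0 <= a x) -> (forall x, 0 <= b x) ->
    (nnsum a < +oo)%E -> (nnsum b < +oo)%E ->
  rsum (fun x => a x - b x) = fine (nnsum a) - fine (nnsum b).
Proof.
move=> a0 b0 aoo boo; pose u x := a x - b x.
have us : abs_summable u.
  apply: (@abs_summable_dom 1 1 a b) => // [x||]; rewrite ?nnsum_summable// !mul1r.
  by rewrite -(normrN (b x)) ler_normD.
have afin := nnsum_fin a0 aoo; have bfin := nnsum_fin b0 boo.
have H : (nnsum (pos u) + nnsum b = nnsum (neg u) + nnsum a)%E.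
  rewrite -!nnsumD//; apply: eq_esum => x _; congr EFin.
  by have := posBneg u x; rewrite {1}/u; lra.
have := congr1 fine H; rewrite !fineD ?(pos_fin us) ?(neg_fin us)//.
by rewrite /rsum -/(pos u) -/(neg u) /nnsum; lra.
Qed.

Lemma rsum_ge0 u : (forall x, 0 <= u x) -> (nnsum u < +oo)%E ->
  rsum u = fine (nnsum u).
Proof.
move=> u0 uoo; have := @rsumB u (fun=> 0) u0 (fun=> lexx 0) uoo.
rewrite nnsum0 ltry => /(_ isT) /=; rewrite subr0 => <-.
by congr rsum; apply/funext => x; rewrite subr0.
Qed.

Lemma rsumD u v : abs_summable u -> abs_summable v ->
  rsum (fun x => u x + v x) = rsum u + rsum v.
Proof.
move=> us vs.
have [pu nu] := (pos_fin us, neg_fin us); have [pv nv] := (pos_fin vs, neg_fin vs).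
have foo (f g : X -> R) : (forall x, 0 <= f x) -> (forall x, 0 <= g x) ->
    nnsum f \is a fin_num -> nnsum g \is a fin_num ->
    (nnsum (fun x => f x + g x)%R < +oo)%E.
  by move=> f0 g0 /fineK ff /fineK gf; rewrite nnsumD// -ff -gf -EFinD ltry.
have -> : (fun x => u x + v x)
    = (fun x => pos u x + pos v x - (neg u x + neg v x)).
  by apply/funext => x; rewrite [u x]posBneg [v x]posBneg; lra.
rewrite rsumB ?foo// => [|x|x]; rewrite ?addr_ge0//.
by rewrite !nnsumD// !fineD// /rsum; lra.
Qed.

Lemma rsumZ (c : R) u : abs_summable u -> rsum (fun x => c * u x) = c * rsum u.
Proof.
move=> us; have [pf nf] := (pos_fin us, neg_fin us).
have foo (v : X -> R) : (forall x, 0 <= v x) -> nnsum v \is a fin_num ->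
    (nnsum (fun x => `|c| * v x)%R < +oo)%E.
  by move=> v0 /fineK vf; rewrite nnsumZ// -vf -EFinM ltry.
have key (v w : X -> R) : (forall x, 0 <= v x) -> (forall x, 0 <= w x) ->
    nnsum v \is a fin_num -> nnsum w \is a fin_num ->
    rsum (fun x => `|c| * v x - `|c| * w x)
    = `|c| * (fine (nnsum v) - fine (nnsum w)).
  move=> v0 w0 vf wf; rewrite rsumB ?foo// => [|x|x]; rewrite ?mulr_ge0//.
  by rewrite !nnsumZ// !fineM// mulrBr.
have [c0|c0] := leP 0 c.
  have -> : c * rsum u = `|c| * (fine (nnsum (pos u)) - fine (nnsum (neg u))).
    by rewrite ger0_norm.
  rewrite -(key _ _ (pos_ge0 u) (neg_ge0 u) pf nf).
  by congr rsum; apply/funext => x; rewrite -mulrBr -posBneg ger0_norm.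
have -> : c * rsum u = `|c| * (fine (nnsum (neg u)) - fine (nnsum (pos u))).
  by rewrite ltr0_norm// /rsum -/(pos u) -/(neg u); lra.
rewrite -(key _ _ (neg_ge0 u) (pos_ge0 u) nf pf).
congr rsum; apply/funext => x; rewrite -mulrBr ltr0_norm//.
by have := posBneg u x; set p := pos u x; set q := neg u x => ->; lra.
Qed.

Lemma nnsum_bij (s t : X -> X) u : cancel s t -> cancel t s ->
  nnsum (u \o s) = nnsum u.
Proof.
move=> sK tK; rewrite /nnsum; apply/esym.
apply: (@reindex_esum _ _ _ setT setT s (EFin \o u)).
by split=> // [x y _ _ /(can_inj sK)//|y _]; exists (t y).
Qed.

Lemma rsum_bij (s t : X -> X) u : cancel s t -> cancel t s ->
  rsum (u \o s) = rsum u.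
Proof.
move=> sK tK; rewrite /rsum.
by rewrite (nnsum_bij (pos u) sK tK) (nnsum_bij (neg u) sK tK).
Qed.

Lemma nnsum_ge_fset (A : {fset X}) u : (forall x, 0 <= u x) ->
  ((\sum_(x <- A) u x)%:E <= nnsum u)%E.
Proof.
move=> u0; apply: esum_ge; exists [set` A].
  by split=> //; exact: finite_fset.
by rewrite fsbig_finite//= set_fsetK sumEFin.
Qed.

Lemma nnsum_le_fset (M : R) u : (forall x, 0 <= u x) ->
  (forall A : {fset X}, \sum_(x <- A) u x <= M) -> (nnsum u <= M%:E)%E.
Proof.
move=> u0 uM; apply: ge_ereal_sup => _ [A [fA _] <-].
by rewrite fsbig_finite//= sumEFin lee_fin.
Qed.

Lemma nnsum_fset (A : {fset X}) u : (forall x, 0 <= u x) ->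
  (forall x, x \notin A -> u x = 0) -> nnsum u = (\sum_(x <- A) u x)%:E.
Proof.
move=> u0 uA; apply/eqP; rewrite eq_le nnsum_ge_fset// andbT.
apply: nnsum_le_fset => // B.
rewrite (big_fsetID _ (mem A))/= [X in _ + X]big1_fset ?addr0; last first.
  by move=> x; rewrite !inE => /andP[_ /uA ->].
rewrite [leRHS](big_fsetID _ (mem B))/=.
rewrite (_ : [fset x in B | x \in A]%fset = [fset x in A | x \in B]%fset); last first.
  by apply/fsetP => x; rewrite !inE andbC.
by rewrite lerDl sumr_ge0.
Qed.

Lemma nnsum_approx (e : R) u : (forall x, 0 <= u x) -> (nnsum u < +oo)%E ->
  0 < e -> exists A : {fset X}, fine (nnsum u) - e < \sum_(x <- A) u x.
Proof.
move=> u0 uoo e0; apply: contrapT => H.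
have : (nnsum u <= (fine (nnsum u) - e)%:E)%E.
  apply: nnsum_le_fset => // A; rewrite leNgt; apply/negP => uA.
  by apply: H; exists A.
have /fineK <- := nnsum_fin u0 uoo; rewrite lee_fin /=; lra.
Qed.

End RealSums.

Section SumsAlong.
Variables (R : realType) (X Y : choiceType) (s : X -> Y).
Hypothesis sI : injective s.

Lemma nnsum_comp_le (u : Y -> R) : (forall y, 0 <= u y) ->
  (nnsum (u \o s) <= nnsum u)%E.
Proof.
move=> u0; rewrite /nnsum -(@esum_image _ _ _ setT s (EFin \o u)); last first.
  by move=> x y _ _ /sI.
by apply: ereal_sup_le => _ [A [finA _] <-]; exists A.
Qed.

Lemma nnsum_comp (u : Y -> R) : (forall y, 0 <= u y) ->
  (forall y, u y != 0 -> exists x, y = s x) -> nnsum (u \o s) = nnsum u.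
Proof.
move=> u0 us; rewrite /nnsum -(@esum_image _ _ _ setT s (EFin \o u)); last first.
  by move=> x y _ _ /sI.
rewrite [RHS](esumID (s @` setT)); last by move=> y _; rewrite lee_fin.
rewrite !setTI [X in _ = (_ + X)%E]esum1 ?adde0// => y /= ny.
apply: contrapT => /eqP uy0; have [|x yx] := us y.
  by apply: contra uy0 => /eqP ->.
by apply: ny; exists x.
Qed.

End SumsAlong.

(** * Complex-valued sums *)

Section ComplexFacts.
Variable R : realType.
Implicit Types z w : R[i].

Lemma sqr_normc_ReIm z : normc z ^+ 2 = complex.Re z ^+ 2 + complex.Im z ^+ 2.
Proof. by case: z => a b /=; rewrite sqr_sqrtr// addr_ge0 ?sqr_ge0. Qed.

Lemma normc_conj z : normc z^*%C = normc z.
Proof. by case: z => a b /=; rewrite sqrrN. Qed.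

Lemma normc_real (x : R) : normc x%:C%C = `|x|.
Proof. by rewrite /= expr0n addr0 sqrtr_sqr. Qed.

Lemma ler_Re_normc z : `|complex.Re z| <= normc z.
Proof.
rewrite -(@ler_pXn2r _ 2)// ?nnegrE ?normr_ge0 ?normc_ge0// sqr_normc_ReIm.
by rewrite real_normK ?num_real// lerDl sqr_ge0.
Qed.

Lemma ler_Im_normc z : `|complex.Im z| <= normc z.
Proof.
rewrite -(@ler_pXn2r _ 2)// ?nnegrE ?normr_ge0 ?normc_ge0// sqr_normc_ReIm.
by rewrite real_normK ?num_real// lerDr sqr_ge0.
Qed.

Lemma mulc_conj z : z * z^*%C = (normc z ^+ 2)%:C%C.
Proof.
rewrite sqr_normc_ReIm; case: z => a b; apply/eqP; rewrite eq_complex /= !expr2.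
by apply/andP; split; apply/eqP; ring.
Qed.

Lemma ReD z w : complex.Re (z + w) = complex.Re z + complex.Re w.
Proof. by case: z w => a b []. Qed.

Lemma ImD z w : complex.Im (z + w) = complex.Im z + complex.Im w.
Proof. by case: z w => a b []. Qed.

Lemma ReM z w : complex.Re (z * w)
  = complex.Re z * complex.Re w - complex.Im z * complex.Im w.
Proof. by case: z w => a b []. Qed.

Lemma ImM z w : complex.Im (z * w)
  = complex.Re z * complex.Im w + complex.Im z * complex.Re w.
Proof. by case: z w => a b []. Qed.

Lemma complexP z w : complex.Re z = complex.Re w ->
  complex.Im z = complex.Im w -> z = w.
Proof. by case: z w => a b [c d] /= -> ->. Qed.

Lemma rc_inj (x y : R) : x%:C%C = y%:C%C :> R[i] -> x = y.
Proof. by case. Qed.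

Lemma rcD (x y : R) : (x + y)%:C%C = x%:C%C + y%:C%C :> R[i].
Proof. exact: rmorphD. Qed.

Lemma rcB (x y : R) : (x - y)%:C%C = x%:C%C - y%:C%C :> R[i].
Proof. exact: rmorphB. Qed.

Lemma rcM (x y : R) : (x * y)%:C%C = x%:C%C * y%:C%C :> R[i].
Proof. exact: rmorphM. Qed.

End ComplexFacts.

Section ComplexSums.
Variables (R : realType) (X : choiceType).
Implicit Types f g : X -> R[i].

Definition csummable f : Prop := (nnsum (fun x => normc (f x)) < +oo)%E.

Let Re_summable f : csummable f -> abs_summable (fun x => complex.Re (f x)).
Proof. by apply: le_lt_trans; apply: le_nnsum => x; exact: ler_Re_normc. Qed.

Let Im_summable f : csummable f -> abs_summable (fun x => complex.Im (f x)).
Proof. by apply: le_lt_trans; apply: le_nnsum => x; exact: ler_Im_normc. Qed.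

Lemma csummableZ (c : R[i]) f : csummable f -> csummable (fun x => c * f x).
Proof.
move=> fs; have c0 := normc_ge0 c.
apply: (@nnsum_lty _ _ _ 0 _ _ _ c0 (lexx 0) _ _ _ fs fs) => x;
  rewrite ?normc_ge0//.
by rewrite normcM mul0r addr0.
Qed.

Lemma csumD f g : csummable f -> csummable g ->
  csum (fun x => f x + g x) = csum f + csum g.
Proof.
move=> fs gs; apply: complexP; rewrite (ReD, ImD) /=.
  under eq_fun do rewrite ReD.
  by rewrite rsumD//; exact: Re_summable.
under eq_fun do rewrite ImD.
by rewrite rsumD//; exact: Im_summable.
Qed.

Lemma csumZ (c : R[i]) f : csummable f -> csum (fun x => c * f x) = c * csum f.
Proof.
move=> fs; have [rs ms] := (Re_summable fs, Im_summable fs).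
apply: complexP; rewrite (ReM, ImM) /=.
  rewrite -(rsumZ _ rs) -mulNr -(rsumZ _ ms) -rsumD; [|exact: abs_summableZ..].
  by congr rsum; apply/funext => x; rewrite ReM mulNr.
rewrite -(rsumZ _ rs) -(rsumZ _ ms) -rsumD; [|exact: abs_summableZ..].
by congr rsum; apply/funext => x; rewrite ImM.
Qed.

Lemma csum_conj f : csummable f -> csum (fun x => (f x)^*%C) = (csum f)^*%C.
Proof.
move=> fs; apply: complexP => /=.
  by congr rsum; apply/funext => x; case: (f x).
rewrite -mulN1r -rsumZ; last exact: Im_summable.
by congr rsum; apply/funext => x; rewrite mulN1r; case: (f x).
Qed.

Lemma csum_bij (s t : X -> X) f : cancel s t -> cancel t s ->
  csum (f \o s) = csum f.
Proof.
move=> sK tK; apply: complexP => /=.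
  exact: (rsum_bij (fun x => complex.Re (f x)) sK tK).
exact: (rsum_bij (fun x => complex.Im (f x)) sK tK).
Qed.

Lemma csum_nonneg (u : X -> R) : (forall x, 0 <= u x) -> (nnsum u < +oo)%E ->
  csum (fun x => (u x)%:C%C) = (fine (nnsum u))%:C%C.
Proof.
move=> u0 us; apply: complexP => /=; first by rewrite rsum_ge0.
by rewrite rsum_ge0 ?nnsum0 ?ltry.
Qed.

End ComplexSums.

(** * The Hilbert space structure of [l^2] *)

Section InnerProduct.
Variables (R : realType) (X : choiceType).
Implicit Types (f g k : ell2 R X) (c : R[i]).

Lemma ell2_addE f g x : (f + g) x = f x + g x. Proof. by []. Qed.
Lemma ell2_oppE f x : (- f) x = - f x. Proof. by []. Qed.
Lemma ell2_scaleE c f x : (c *: f) x = c * f x. Proof. by []. Qed.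

Lemma ell2_eq f g : (forall x, f x = g x) -> f = g.
Proof. by move=> fg; apply/val_inj/funext. Qed.

Lemma ell2_lty f : (nnsum (fun x => normc (f x) ^+ 2)%R < +oo)%E.
Proof. by have := valP f; rewrite unfold_in. Qed.

Lemma dotp_csummable f g : csummable (fun x => f x * (g x)^*%C).
Proof.
apply: (@nnsum_lty _ _ 1 1 _ _ _ _ _ _ _ _ (ell2_lty f) (ell2_lty g)) => // x;
  rewrite ?sqr_ge0//.
rewrite normcM normc_conj !mul1r.
by have := normc_ge0 (f x); have := normc_ge0 (g x); nra.
Qed.

Lemma dotpC f g : dotp g f = (dotp f g)^*%C.
Proof.
rewrite /dotp -csum_conj; last exact: dotp_csummable.
by congr csum; apply/funext => x; rewrite rmorphM /= conjcK mulrC.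
Qed.

Lemma dotp_linl c f g k : dotp (c *: f + g) k = c * dotp f k + dotp g k.
Proof.
have fk := dotp_csummable f k; have gk := dotp_csummable g k.
rewrite /dotp -csumZ// -csumD//; last exact: csummableZ.
by congr csum; apply/funext => x; rewrite ell2_addE ell2_scaleE mulrDl mulrA.
Qed.

Lemma dotpDl f g k : dotp (f + g) k = dotp f k + dotp g k.
Proof. by have := dotp_linl 1 f g k; rewrite scale1r mul1r. Qed.

Lemma dotp0l k : dotp 0 k = 0.
Proof. by have /eqP := dotpDl 0 0 k; rewrite addr0 -subr_eq subrr => /eqP. Qed.

Lemma dotpZl c f k : dotp (c *: f) k = c * dotp f k.
Proof. by have := dotp_linl c f 0 k; rewrite dotp0l !addr0. Qed.

Lemma dotpNl f k : dotp (- f) k = - dotp f k.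
Proof. by rewrite -scaleN1r dotpZl mulN1r. Qed.

Lemma dotpBl f g k : dotp (f - g) k = dotp f k - dotp g k.
Proof. by rewrite dotpDl dotpNl. Qed.

Lemma dotpDr k f g : dotp k (f + g) = dotp k f + dotp k g.
Proof. by rewrite (dotpC f) (dotpC g) (dotpC (f + g)) dotpDl rmorphD. Qed.

Lemma dotpZr c k f : dotp k (c *: f) = c^*%C * dotp k f.
Proof. by rewrite (dotpC f) (dotpC (c *: f)) dotpZl rmorphM. Qed.

Lemma dotpNr k f : dotp k (- f) = - dotp k f.
Proof. by rewrite (dotpC f) (dotpC (- f)) dotpNl rmorphN. Qed.

Lemma dotpBr k f g : dotp k (f - g) = dotp k f - dotp k g.
Proof. by rewrite (dotpC f) (dotpC g) (dotpC (f - g)) dotpBl rmorphB. Qed.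

Lemma dotpp f : dotp f f = (norm2 f ^+ 2)%:C%C.
Proof.
have f0 x : 0 <= normc (f x) ^+ 2 by exact: sqr_ge0.
rewrite sqr_sqrtr ?fine_ge0 ?nnsum_ge0// -csum_nonneg ?ell2_lty//.
by congr csum; apply/funext => x; rewrite mulc_conj.
Qed.

Lemma norm2Z c f : norm2 (c *: f) = normc c * norm2 f.
Proof.
apply/eqP; rewrite -(@eqrXn2 _ 2) ?mulr_ge0 ?norm2_ge0 ?normc_ge0//.
apply/eqP/rc_inj; rewrite exprMn [RHS]rcM -!dotpp dotpZl dotpZr.
by rewrite mulrA mulc_conj.
Qed.

Lemma norm2N f : norm2 (- f) = norm2 f.
Proof. by rewrite -scaleN1r norm2Z normcN normc1 mul1r. Qed.

Lemma norm2_subC f g : norm2 (f - g) = norm2 (g - f).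
Proof. by rewrite -norm2N opprB. Qed.

Lemma sqr_norm2D f g : norm2 (f + g) ^+ 2
  = norm2 f ^+ 2 + norm2 g ^+ 2 + 2 * complex.Re (dotp f g).
Proof.
apply: rc_inj; rewrite -dotpp dotpDl !dotpDr !dotpp (dotpC f g).
case: (dotp f g) => a b; apply/eqP; rewrite eq_complex /=.
by apply/andP; split; apply/eqP; ring.
Qed.

Lemma norm2_eq0 f : norm2 f = 0 -> f = 0.
Proof.
move=> f0; apply/val_inj/funext => x; apply: eq0_normc.
apply/eqP; rewrite -sqrf_eq0; apply/eqP/le_anti; rewrite sqr_ge0 andbT.
rewrite -lee_fin; apply: le_trans (_ : (norm2 f ^+ 2)%:E <= _)%E.
  rewrite sqr_norm2; apply: le_trans (nnsum_ge_fset [fset x]%fset _).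
    by rewrite big_seq_fset1.
  by move=> y; exact: sqr_ge0.
by rewrite f0 expr0n.
Qed.

Lemma cauchy_schwarz f g : normc (dotp f g) <= norm2 f * norm2 g.
Proof.
have [g0|g0] := eqVneq (norm2 g) 0.
  by rewrite (norm2_eq0 g0) dotpC dotp0l conjc0 normc0 norm20 mulr0.
rewrite -(@ler_pXn2r _ 2)// ?nnegrE ?mulr_ge0 ?norm2_ge0 ?normc_ge0//.
set z := dotp f g; set b := norm2 g ^+ 2.
have b0 : 0 < b by rewrite exprn_gt0// lt_def g0 norm2_ge0.
(* [b f - z g] is [b] times the component of [f] orthogonal to [g] *)
have : 0 <= norm2 (b%:C%C *: f + - z *: g) ^+ 2 by exact: sqr_ge0.
rewrite sqr_norm2D !norm2Z !exprMn dotpZl dotpZr -/z normcN -/b.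
have -> : complex.Re (b%:C%C * ((- z)^*%C * z)) = - (b * normc z ^+ 2).
  by rewrite sqr_normc_ReIm; case: (z) => x y /=; ring.
rewrite normc_real real_normK ?num_real//.
move=> H; have : 0 <= b * (norm2 f ^+ 2 * b - normc z ^+ 2) by lra.
by rewrite pmulr_rge0// subr_ge0.
Qed.

Lemma ler_norm2D f g : norm2 (f + g) <= norm2 f + norm2 g.
Proof.
rewrite -(@ler_pXn2r _ 2)// ?nnegrE ?addr_ge0 ?norm2_ge0// sqr_norm2D.
have := cauchy_schwarz f g; have := ler_Re_normc (dotp f g).
by have := ler_norm (complex.Re (dotp f g)); rewrite sqrrD; lra.
Qed.

Lemma ler_norm2B f g : norm2 (f - g) <= norm2 f + norm2 g.
Proof. by rewrite -(norm2N g) ler_norm2D. Qed.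

Lemma ler_norm2_dist k f g : norm2 (f - g) <= norm2 (f - k) + norm2 (k - g).
Proof. by have := ler_norm2D (f - k) (k - g); rewrite addrA subrK. Qed.

Lemma normc_le_norm2 f x : normc (f x) <= norm2 f.
Proof.
rewrite -(@ler_pXn2r _ 2)// ?nnegrE ?norm2_ge0 ?normc_ge0//.
rewrite -lee_fin sqr_norm2; apply: le_trans (nnsum_ge_fset [fset x]%fset _).
  by rewrite big_seq_fset1.
by move=> y; exact: sqr_ge0.
Qed.

Lemma norm2_le (M : R) f : 0 <= M ->
  (forall A : {fset X}, \sum_(x <- A) normc (f x) ^+ 2 <= M ^+ 2) ->
  norm2 f <= M.
Proof.
move=> M0 fM; rewrite -(@ler_pXn2r _ 2)// ?nnegrE ?norm2_ge0//.
by rewrite -lee_fin sqr_norm2 nnsum_le_fset// => x; exact: sqr_ge0.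
Qed.

End InnerProduct.

(** * Limits of bounded functions along an ultrafilter *)

Section Ultralimits.
Variables (R : realType) (I : Type) (U : set_system I).
Context {UU : UltraFilter U}.
Implicit Types (u : I -> R) (f g : I -> R[i]).

(** By compactness the image ultrafilter has a cluster point; an ultrafilter
    contains every set or its complement, so it converges to that point. *)
Lemma ultra_bounded_cvg u (M : R) : (\forall i \near U, `|u i| <= M) ->
  exists l : R, u @ U --> l.
Proof.
move=> uM; have uU : fmap u U `[- M, M]%classic.
  by apply: filterS uM => i; rewrite /= in_itv /= -ler_norml.
have [a [_ acl]] := segment_compact _ uU; exists a => A aA.
have [//|nA] := in_ultra_setVsetC (u @^-1` A) UU.
by have [y []] := acl (~` A) A nA aA.
Qed.

Definition ccvg f (l : R[i]) : Prop :=
  ((fun i => complex.Re (f i)) @ U --> complex.Re l)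
  /\ ((fun i => complex.Im (f i)) @ U --> complex.Im l).

Definition clim f : R[i] :=
  Complex (lim ((fun i => complex.Re (f i)) @ U))
          (lim ((fun i => complex.Im (f i)) @ U)).

Lemma ccvg_clim f (M : R) : (\forall i \near U, normc (f i) <= M) ->
  ccvg f (clim f).
Proof.
move=> fM; split; apply/cvg_ex; apply: (@ultra_bounded_cvg _ M);
  apply: filterS fM => i; apply: le_trans.
  exact: ler_Re_normc.
exact: ler_Im_normc.
Qed.

Lemma ccvg_unique f l l' : ccvg f l -> ccvg f l' -> l = l'.
Proof. by move=> [a b] [a' b']; apply: complexP;
  [exact: norm_cvg_unique a a' | exact: norm_cvg_unique b b']. Qed.

Lemma ccvgD f g l m : ccvg f l -> ccvg g m -> ccvg (fun i => f i + g i) (l + m).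
Proof.
move=> [a b] [a' b']; split.
  rewrite ReD; under eq_fun do rewrite ReD; exact: cvgD.
rewrite ImD; under eq_fun do rewrite ImD; exact: cvgD.
Qed.

Lemma ccvgZ (c : R[i]) f l : ccvg f l -> ccvg (fun i => c * f i) (c * l).
Proof.
move=> [a b]; split.
  by rewrite ReM; under eq_fun do rewrite ReM; apply: cvgB;
    apply: cvgM => //; exact: cvg_cst.
by rewrite ImM; under eq_fun do rewrite ImM; apply: cvgD;
  apply: cvgM => //; exact: cvg_cst.
Qed.

Lemma ccvg_cst l : ccvg (fun=> l) l.
Proof. by split; exact: cvg_cst. Qed.

Lemma ccvg_sqr_normc f l : ccvg f l ->
  (fun i => normc (f i) ^+ 2) @ U --> normc l ^+ 2.
Proof.
move=> [a b]; rewrite sqr_normc_ReIm.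
under eq_fun do rewrite sqr_normc_ReIm !expr2.
by rewrite !expr2; apply: cvgD; apply: cvgM.
Qed.

Lemma ccvg_near_eq f g l : (\forall i \near U, f i = g i) ->
  ccvg f l -> ccvg g l.
Proof.
by move=> fg [a b]; split; [apply: cvg_trans a | apply: cvg_trans b];
  apply: near_eq_cvg; apply: filterS fg => i ->.
Qed.

Lemma ccvg_small f l :
  (forall e : R, 0 < e -> \forall i \near U, normc (f i - l) <= e) -> ccvg f l.
Proof.
move=> fl; split; apply/cvgrPdist_le => e e0; apply: filterS (fl e e0) => i;
  apply: le_trans; rewrite distrC.
  by have := ler_Re_normc (f i - l); case: (f i) (l) => a b [c d].
by have := ler_Im_normc (f i - l); case: (f i) (l) => a b [c d].
Qed.

Lemma ccvg_ge0 f l : (\forall i \near U, 0 <= f i) -> ccvg f l -> 0 <= l.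
Proof.
move=> f0 [a b]; rewrite lecE; apply/andP; split.
  apply/eqP; apply: (norm_cvg_unique b); apply: (cvg_trans _ (@cvg_cst R 0 I U _)).
  apply: near_eq_cvg; apply: filterS f0 => i; rewrite lecE => /andP[/eqP /= ->//].
apply: (@cvgr_to_ge _ _ _ _ _ _ _ a).
by apply: filterS f0 => i; rewrite lecE => /andP[].
Qed.

End Ultralimits.

(** * Completeness of [l^2] and the Neumann series *)

Section Bop.
Variables (R : realType) (X : choiceType).
Implicit Types (S T : bop R X) (f g : ell2 R X).

Lemma bopDr T f g : T (f + g) = T f + T g.
Proof. by have [Tl _] := bopP T; have := Tl 1 f g; rewrite !scale1r. Qed.

Lemma bop0r T : T 0 = 0.
Proof. by have /eqP := bopDr T 0 0; rewrite addr0 -subr_eq subrr => /eqP. Qed.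

Lemma bopZr T c f : T (c *: f) = c *: T f.
Proof. by have [Tl _] := bopP T; have := Tl c f 0; rewrite bop0r !addr0. Qed.

Lemma bopBr T f g : T (f - g) = T f - T g.
Proof. by rewrite bopDr -scaleN1r bopZr scaleN1r. Qed.

Lemma bop_addE S T f : (S + T) f = S f + T f. Proof. by []. Qed.
Lemma bop_oppE T f : (- T) f = - T f. Proof. by []. Qed.
Lemma bop_scaleE c T f : (c *: T) f = c *: T f. Proof. by []. Qed.
Lemma bop_mulE S T f : (S * T) f = S (T f). Proof. by []. Qed.
Lemma bop_oneE f : (1 : bop R X) f = f. Proof. by []. Qed.

Lemma bop_eq S T : (forall f, S f = T f) -> S = T.
Proof. by move=> ST; apply/val_inj/funext. Qed.

Lemma bop_sumE (J : Type) (r : seq J) (P : pred J) (T : J -> bop R X) f :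
  (\sum_(j <- r | P j) T j) f = \sum_(j <- r | P j) T j f.
Proof.
by elim/big_ind2: _ => // S1 f1 S2 f2 <- <-.
Qed.

Lemma bop_bounded T : exists2 M : R, 0 <= M & forall f, norm2 (T f) <= M * norm2 f.
Proof.
have [_ [M TM]] := bopP T; exists `|M| => // f; apply: le_trans (TM f) _.
by rewrite ler_wpM2r ?norm2_ge0 ?ler_norm.
Qed.

(** The limit is taken pointwise along an ultrafilter, so that boundedness is
    all that is needed at each point; the rate passes to the limit in every
    finite partial sum of the square norm. *)
Lemma ell2_complete (f_ : nat -> ell2 R X) (e : nat -> R) :
  (forall n m, (n <= m)%N -> norm2 (f_ m - f_ n) <= e n) ->
  exists f, forall n, norm2 (f - f_ n) <= e n.
Proof.
move=> fe; have e0 n : 0 <= e n by apply: le_trans (fe n n _); rewrite ?norm2_ge0.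
have [U [UU leU]] := @ultraFilterLemma nat \oo _.
have near_ge n : \forall m \near U, (n <= m)%N by apply: leU; exists n.
pose f x := clim U (fun m => f_ m x).
have fcvg x : ccvg U (fun m => f_ m x) (f x).
  apply: (@ccvg_clim _ _ _ _ _ (norm2 (f_ 0%N) + e 0%N)).
  near=> m; apply: le_trans (normc_le_norm2 _ _) _.
  by rewrite -[f_ m](subrK (f_ 0%N)) addrC (le_trans (ler_norm2D _ _))// lerD// fe.
have fle n (A : {fset X}) : \sum_(x <- A) normc (f x - f_ n x) ^+ 2 <= e n ^+ 2.
  have near_le : \forall m \near U,
      \sum_(x <- A) normc (f_ m x - f_ n x) ^+ 2 <= e n ^+ 2.
    apply: filterS (near_ge n) => m nm.
    apply: (@le_trans _ _ (norm2 (f_ m - f_ n) ^+ 2)).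
      rewrite -lee_fin sqr_norm2; apply: nnsum_ge_fset => x; exact: sqr_ge0.
    by rewrite lerXn2r ?nnegrE ?norm2_ge0// fe.
  apply: cvgr_to_le near_le.
  apply: cvg_big => [|x _]; [exact: add_continuous | apply: ccvg_sqr_normc].
  apply: ccvgD (fcvg x) _; exact: ccvg_cst.
have gP : (fun x => f x - f_ 0%N x) \in @is_ell2 R X.
  rewrite unfold_in; apply: le_lt_trans (ltry (e 0%N ^+ 2)).
  by apply: nnsum_le_fset => [x|//]; exact: sqr_ge0.
exists (Ell2 gP + f_ 0%N) => n; apply: norm2_le => // A.
apply: le_trans (fle n A); rewrite le_eqVlt; apply/orP; left; apply/eqP.
by apply: eq_bigr => x _; rewrite !ell2_addE /= subrK.
Unshelve. all: by end_near. Qed.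

(** Bounding [1 - T] below makes it injective and its inverse bounded, while
    surjectivity is the convergence of the series of the [T^n g]. *)
Lemma neumann_inverse T (c : R) : 0 <= c -> c < 1 ->
    (forall f, norm2 (T f) <= c * norm2 f) ->
  exists S, S * (1 - T) = 1 /\ (1 - T) * S = 1.
Proof.
move=> c0 c1 Tc; have c1' : 0 < 1 - c by rewrite subr_gt0.
have lower f : (1 - c) * norm2 f <= norm2 ((1 - T) f).
  rewrite bop_addE bop_oppE bop_oneE.
  have := ler_norm2D (f - T f) (T f); rewrite subrK; have := Tc f; lra.
have inj f g : (1 - T) f = (1 - T) g -> f = g.
  move=> fg; apply/eqP; rewrite -subr_eq0; apply/eqP/norm2_eq0/le_anti.
  rewrite norm2_ge0 andbT; have := lower (f - g).
  by rewrite bopBr fg subrr norm20 pmulr_rle0.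
have surj g : exists f, (1 - T) f = g.
  (* the partial sums of the Neumann series applied to [g] *)
  pose f_ n := iter n (fun f => g + T f) 0.
  have f_S n : norm2 (f_ n.+1 - f_ n) <= c ^+ n * norm2 g.
    elim: n => [|n IHn]; first by rewrite /f_ /= bop0r subr0 addr0 expr0 mul1r.
    rewrite [f_ n.+2]/f_ [f_ n.+1]/f_ !iterS -!/(f_ _) -/(f_ n.+1).
    rewrite opprD addrACA subrr add0r -bopBr exprS -mulrA.
    by apply: le_trans (Tc _) _; rewrite ler_wpM2l.
  have f_le n m : (n <= m)%N ->
      norm2 (f_ m - f_ n) <= c ^+ n / (1 - c) * norm2 g.
    move=> /subnKC <-; move: (m - n)%N => {}m.
    (* the sum of [c ^+ k] for [n <= k < n + m] *)
    suff H : norm2 (f_ (n + m)%N - f_ n)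
        <= (c ^+ n - c ^+ (n + m)) / (1 - c) * norm2 g.
      apply: le_trans H _; rewrite ler_wpM2r ?norm2_ge0// ler_pM2r ?invr_gt0//.
      by rewrite gerBl exprn_ge0.
    elim: m => [|m IHm]; first by rewrite addn0 !subrr norm20 !mul0r.
    apply: le_trans (ler_norm2_dist (f_ (n + m)%N) _ _) _.
    rewrite addnS; apply: le_trans (lerD (f_S _) IHm) _.
    rewrite -mulrDl ler_wpM2r ?norm2_ge0// exprS; set x := c ^+ (n + m).
    by rewrite ler_pdivlMr// mulrDl divfK ?gt_eqF//; lra.
  have [f fP] := ell2_complete f_le; exists f.
  apply/eqP; rewrite -subr_eq0; apply/eqP/norm2_eq0/le_anti.
  rewrite norm2_ge0 andbT; apply/ler_addgt0Pl => e e0; rewrite addr0.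
  have [n nP] : exists n, c ^+ n * (2 * norm2 g / (1 - c)) <= e.
    have : (fun n => c ^+ n * (2 * norm2 g / (1 - c))) @ \oo --> (0 : R).
      rewrite -[0](mul0r (2 * norm2 g / (1 - c))).
      by apply: cvgM; [apply: cvg_expr; rewrite ger0_norm | exact: cvg_cst].
    by move/cvgr_le => /(_ _ e0)[n _ nP]; exists n; apply: nP => /=.
  apply: le_trans nP.
  have -> : (1 - T) f - g = (f - f_ n.+1) - T (f - f_ n).
    rewrite bopBr bop_addE bop_oppE bop_oneE [f_ n.+1]/f_ iterS -/(f_ n).
    by rewrite (opprD g) addrA opprB subrKA addrAC.
  have := ler_norm2B (f - f_ n.+1) (T (f - f_ n)); have := Tc (f - f_ n).
  have := fP n; have := fP n.+1; rewrite exprS.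
  have : 0 <= c ^+ n / (1 - c) * norm2 g.
    by rewrite mulr_ge0 ?norm2_ge0// divr_ge0 ?exprn_ge0// ltW.
  set p := c ^+ n; set q := (1 - c)^-1; set r := norm2 g.
  have := norm2_ge0 (f - f_ n); nra.
pose S f := projT1 (cid (surj f)).
have SP f : (1 - T) (S f) = f by rewrite /S; case: cid.
have Sb : S \in @is_bop R X.
  rewrite unfold_in; apply/asboolP; split=> [a f g|].
    by apply: inj; rewrite SP bopDr bopZr !SP.
  exists (1 - c)^-1 => f; rewrite ler_pdivlMl//.
  by apply: le_trans (lower _) _; rewrite SP.
exists (Bop Sb); split; apply: bop_eq => f; rewrite bop_mulE /=; last exact: SP.
by apply: inj; rewrite SP.
Qed.

Lemma opnorm_bound T f : norm2 (T f) <= opnorm T * norm2 f.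
Proof.
have [M M0 TM] := bop_bounded T.
have [f0|f0] := eqVneq (norm2 f) 0.
  by rewrite f0 mulr0 (norm2_eq0 f0) bop0r norm20.
have f_gt0 : 0 < norm2 f by rewrite lt_def f0 norm2_ge0.
rewrite -ler_pdivrMr//; pose g := ((norm2 f)^-1)%:C%C *: f.
have nu : normc ((norm2 f)^-1)%:C%C = (norm2 f)^-1.
  by rewrite normc_real ger0_norm// invr_ge0 norm2_ge0.
apply: sup_upper_bound => /=; first split.
- by exists (norm2 (T 0)), 0 => //=; rewrite norm20.
- exists M => _ [h /= h1 <-]; apply: le_trans (TM h) _.
  by rewrite -[leRHS]mulr1 ler_wpM2l.
exists g => /=; first by rewrite norm2Z nu mulVf.
by rewrite bopZr norm2Z nu mulrC.
Qed.

End Bop.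

(** * Nets and finite approximations *)

Section Nets.
Variable R : realType.

Lemma tails_filter (I : Type) (le : I -> I -> Prop) :
  directed le -> ProperFilter (tails le).
Proof.
move=> [[i0] lexx le_trans le_dir]; apply: filter_from_proper.
  apply: filter_from_filter; first by exists i0.
  move=> i j _ _; have [k [ik jk]] := le_dir i j; exists k => // l /= kl.
  by split; exact: le_trans kl.
by move=> i _; exists i => /=.
Qed.

Section NetOf.
Variables (K : choiceType) (E : Type) (P : E -> Prop) (Q : K -> Prop).
Variable d : K -> E -> R.

Definition approximable : Prop := forall (s : seq K) (e : R), 0 < e ->
  exists2 x, P x & forall k, k \in s -> Q k -> d k x <= e.

Lemma approximable_of_net :
    (exists (I : Type) (le : I -> I -> Prop) (x : I -> E),
      [/\ directed le, forall n, P (x n) &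
          forall k, Q k -> (fun n => d k (x n)) @ tails le --> (0 : R)]) ->
  approximable.
Proof.
move=> [I [le [x [dir Px dx]]]] s e e0; have FF := tails_filter dir.
have H : \forall n \near tails le, forall k, k \in s -> Q k -> d k (x n) <= e.
  elim: s => [|k s IHs]; first exact: filterE.
  have Hk : \forall n \near tails le, Q k -> d k (x n) <= e.
    have [Qk|nQk] := pselect (Q k); last exact: filterE.
    have le_e : \forall n \near tails le, d k (x n) <= e.
      exact: (cvgr_le _ (dx k Qk) _ e0).
    by apply: filterS le_e => n ? _.
  apply: filterS2 Hk IHs => n dk ds j; rewrite inE => /predU1P[->//|js].
  exact: ds.
by have [n nP] := @filter_ex _ _ FF _ H; exists (x n).
Qed.

(** The index set pairs a finite set of conditions with a precision. *)
Lemma net_of_approximable : approximable -> (forall k x, 0 <= d k x) ->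
  exists (I : Type) (le : I -> I -> Prop) (x : I -> E),
    [/\ directed le, forall n, P (x n) &
        forall k, Q k -> (fun n => d k (x n)) @ tails le --> (0 : R)].
Proof.
move=> H d_ge0; pose I := (seq K * nat)%type.
pose le (i j : I) := {subset i.1 <= j.1} /\ (i.2 <= j.2)%N.
have {}H (i : I) : {x | P x /\ forall k, k \in i.1 -> Q k -> d k x <= i.2.+1%:R^-1}.
  apply: cid; have [|x Px dx] := H i.1 (i.2.+1%:R^-1); first by rewrite invr_gt0.
  by exists x.
exists I, le, (fun i => projT1 (H i)).
have dir : directed le.
  split; first by constructor; exact: ([::], 0%N).
  - by move=> i; split.
  - move=> i j k [ij ij2] [jk jk2]; split; last exact: leq_trans jk2.
    by move=> a /ij /jk.
  move=> i j; exists (i.1 ++ j.1, maxn i.2 j.2); split; split => /=;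
    rewrite ?leq_maxl ?leq_maxr// => a; rewrite mem_cat => ->//.
  by rewrite orbT.
split=> // [i|k Qk]; first by case: (H i) => x [].
have FF := tails_filter dir.
apply/cvgr0Pnorm_le => e e0; have := truncnS_gt e^-1; set N := Num.truncn _ => eN.
exists ([:: k], N) => // i [ki Ni] /=; rewrite ger0_norm//.
case: (H i) => x [_] /= /(_ k) dx; apply: le_trans (dx _ Qk) _.
  by apply: ki; rewrite inE.
rewrite invf_ple ?posrE//; apply: ltW; apply: lt_le_trans eN _.
by rewrite ler_nat.
Qed.

End NetOf.
End Nets.

(** * The Hahn-Banach theorem *)

Section HahnBanach.
Variables (R : realType) (V : lmodType R).
Implicit Types (p q : V -> R) (C : V -> R -> Prop).

Definition sublinear q : Prop :=
  (forall x y, q (x + y) <= q x + q y)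
  /\ (forall a x, 0 <= a -> q (a *: x) = a * q x).

Definition convex_cone C : Prop :=
  [/\ C 0 0, forall v r w s, C v r -> C w s -> C (v + w) (r + s) &
      forall a v r, 0 <= a -> C v r -> C (a *: v) (a * r)].

Lemma sublinear0 q : sublinear q -> q 0 = 0.
Proof. by move=> [_ /(_ 0 0 (lexx 0))]; rewrite scale0r mul0r. Qed.

Lemma sublinear_ge q x : sublinear q -> - q (- x) <= q x.
Proof.
by move=> qs; have := qs.1 x (- x); rewrite subrr sublinear0// => H; lra.
Qed.

(** The infimum below is sublinear, lies under [q], and takes a value at most
    [- r] at [- v] for each [(v, r)] in the cone [C]. It serves twice: with a ray
    in the proof of the Hahn-Banach theorem, and with a cone of constraints in
    its Mazur-Orlicz form. *)
Section ConeInf.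
Variables (q : V -> R) (C : V -> R -> Prop).
Hypotheses (qs : sublinear q) (CC : convex_cone C).
Hypothesis Cq : forall v r, C v r -> r <= q v.

Let values x := [set a | exists v r, C v r /\ a = q (x + v) - r].

Definition cone_inf x : R := inf (values x).

Let values_lb x : lbound (values x) (- q (- x)).
Proof.
move=> _ [v [r [/Cq rq ->]]]; have := qs.1 (x + v) (- x).
by rewrite addrAC subrr add0r; lra.
Qed.

Lemma cone_inf_le x v r : C v r -> cone_inf x <= q (x + v) - r.
Proof. by move=> Cvr; apply: ge_inf; [exists (- q (- x)) | exists v, r]. Qed.

Let cone_inf_ge x (a : R) :
  (forall v r, C v r -> a <= q (x + v) - r) -> a <= cone_inf x.
Proof.
move=> H; apply: lb_le_inf; last by move=> _ [v [r [Cvr ->]]]; exact: H.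
by exists (q (x + 0) - 0); exists 0, 0; split=> //; case: CC.
Qed.

Lemma cone_inf_sublinear : sublinear cone_inf.
Proof.
have [C0 CD CZ] := CC.
have scale_le a x : 0 < a -> cone_inf (a *: x) <= a * cone_inf x.
  move=> a0; rewrite -ler_pdivrMl//; apply: cone_inf_ge => v r Cvr.
  rewrite ler_pdivrMl// mulrBr -(qs.2 _ _ (ltW a0)) scalerDr.
  by apply: cone_inf_le; apply: CZ => //; exact: ltW.
split=> [x y|a x].
  rewrite -lerBlDr; apply: cone_inf_ge => v r Cv.
  rewrite lerBlDr -lerBlDl; apply: cone_inf_ge => w s Cw.
  have := cone_inf_le (x + y) (CD _ _ _ _ Cv Cw); rewrite addrACA.
  by have := qs.1 (x + v) (y + w); lra.
rewrite le_eqVlt => /predU1P[<-|a0].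
  rewrite scale0r mul0r; apply/le_anti/andP; split.
    by have := cone_inf_le 0 C0; rewrite addr0 (sublinear0 qs) subr0.
  by apply: cone_inf_ge => v r /Cq; rewrite add0r subr_ge0.
apply/le_anti; rewrite scale_le//= -ler_pdivlMl//.
have := scale_le a^-1 (a *: x); rewrite scalerK ?gt_eqF// invr_gt0; exact.
Qed.

End ConeInf.

Definition linear_form (u : V -> R) : Prop :=
  (forall x y, u (x + y) = u x + u y) /\ (forall a x, u (a *: x) = a * u x).

(** A minimal sublinear functional [q] is linear: lowering it along the ray of
    [y] gives a sublinear functional below [q] whose value at [- y] is at most
    [- q y], so that minimality forces [q (- y) = - q y]. *)
Lemma hahn_banach p : sublinear p ->
  exists2 u, linear_form u & forall x, u x <= p x.
Proof.
move=> ps; pose Tq q := sublinear q /\ forall x, q x <= p x.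
pose T := {q : V -> R | Tq q}.
pose rel_T (s t : T) : bool := `[< forall x, projT1 t x <= projT1 s x >].
have Tge (s : T) x : - p (- x) <= projT1 s x.
  have [ss sp] := projT2 s.
  by apply: le_trans (sublinear_ge x ss); rewrite lerN2.
have [||s t /asboolP st /asboolP ts|A Atot|] := @Zorn T rel_T.
- by move=> s; apply/asboolP.
- by move=> r s t /asboolP rs /asboolP st; apply/asboolP => x; exact: le_trans (rs x).
- case: s t st ts => [s sP] [t tP] /= st ts; apply: eq_exist => /=.
  by apply/funext => x; apply/le_anti; rewrite st ts.
- have [[s0 As0]|A0] := pselect (exists s, A s); last first.
    exists (exist _ p (conj ps (fun x => lexx (p x)))) => s As.
    by exfalso; apply: A0; exists s.
  pose vals x := [set projT1 s x | s in A].
  have lb x : has_inf (vals x).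
    split; first by exists (projT1 s0 x), s0.
    by exists (- p (- x)) => _ [s _ <-]; exact: Tge.
  have inf_le s x : A s -> inf (vals x) <= projT1 s x.
    by move=> As; apply: ge_inf; [case: (lb x) | exists s].
  have inf_ge x a : (forall s, A s -> a <= projT1 s x) -> a <= inf (vals x).
    by move=> H; apply: lb_le_inf; [case: (lb x) | move=> _ [s As <-]; exact: H].
  have qP : sublinear (fun x => inf (vals x)) /\ forall x, inf (vals x) <= p x.
    split; last first.
      by move=> x; apply: le_trans (inf_le s0 x As0) _; case: (projT2 s0).
    have scale_le a x : 0 < a -> inf (vals (a *: x)) <= a * inf (vals x).
      move=> a0; rewrite -ler_pdivrMl//; apply: (inf_ge) => s As.
      have [[_ sZ] _] := projT2 s; rewrite ler_pdivrMl// -(sZ _ _ (ltW a0)).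
      exact: inf_le.
    split=> [x y|a x].
      rewrite -lerBlDr; apply: (inf_ge) => s As.
      rewrite lerBlDr -lerBlDl; apply: (inf_ge) => t At.
      rewrite lerBlDl; have [[sD _] _] := projT2 s; have [[tD _] _] := projT2 t.
      have [/asboolP H|/asboolP H] := Atot s t As At.
        apply: le_trans (inf_le t _ At) _; apply: le_trans (tD _ _) _.
        by rewrite lerD2r.
      apply: le_trans (inf_le s _ As) _; apply: le_trans (sD _ _) _.
      by rewrite lerD2l.
    rewrite le_eqVlt => /predU1P[<-|a0].
      rewrite scale0r mul0r; apply/le_anti/andP; split.
        by apply: le_trans (inf_le s0 0 As0) _; rewrite sublinear0//; case: (projT2 s0).
      by apply: (inf_ge) => s _; rewrite sublinear0//; case: (projT2 s).
    apply/le_anti; rewrite scale_le//= -ler_pdivlMl//.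
    have := scale_le a^-1 (a *: x); rewrite scalerK ?gt_eqF// invr_gt0; exact.
    by exists (exist Tq (fun x => inf (vals x)) qP) => s As;
    apply/asboolP => x /=; exact: inf_le.
move=> [q [qs qp]] qmin.
have qN y : q (- y) = - q y.
  pose C v r := exists2 t, 0 <= t & v = t *: y /\ r = t * q y.
  have CC : convex_cone C.
    split; first by exists 0 => //; rewrite scale0r mul0r.
      move=> v r w s [t t0 [-> ->]] [t' t'0 [-> ->]]; exists (t + t').
        exact: addr_ge0.
      by rewrite scalerDl mulrDl.
    move=> a v r a0 [t t0 [-> ->]]; exists (a * t); first exact: mulr_ge0.
    by rewrite scalerA mulrA.
  have Cq v r : C v r -> r <= q v by move=> [t t0 [-> ->]]; rewrite qs.2.
  have C1 : C y (q y) by exists 1 => //; rewrite scale1r mul1r.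
  have le_q x : cone_inf q C x <= q x.
    by have [C0 _ _] := CC; have := cone_inf_le qs Cq x C0; rewrite addr0 subr0.
  have cP : sublinear (cone_inf q C) /\ forall x, cone_inf q C x <= p x.
    by split=> [|x]; [exact: cone_inf_sublinear | exact: le_trans (qp x)].
  have qE : cone_inf q C (- y) = q (- y).
    have -> // : cone_inf q C = q.
    suff [] : exist Tq (cone_inf q C) cP = exist Tq q (conj qs qp) by [].
    by apply: qmin; apply/asboolP.
  apply/le_anti/andP; split; last by have := sublinear_ge (- y) qs; rewrite opprK.
  by have := cone_inf_le qs Cq (- y) C1; rewrite addNr (sublinear0 qs) qE sub0r.
exists q => //; split=> [x y|a x].
  apply/le_anti; rewrite qs.1 /=; have := qs.1 (x + y) (- y).
  by rewrite addrK qN; lra.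
have [a0|a0] := leP 0 a; first exact: qs.2.
rewrite -[a]opprK scaleNr qN qs.2 ?mulNr//; lra.
Qed.

(** The Mazur-Orlicz form of the theorem: the constraints [r <= u v] can be met
    by a linear form [u <= p] as soon as they are met by [p] itself. *)
Lemma mazur_orlicz p C : sublinear p -> convex_cone C ->
    (forall v r, C v r -> r <= p v) ->
  exists u, [/\ linear_form u, forall x, u x <= p x & forall v r, C v r -> r <= u v].
Proof.
move=> ps CC Cp; have [u ul up] := hahn_banach (cone_inf_sublinear ps CC Cp).
have uN x : u (- x) = - u x by rewrite -scaleN1r ul.2 mulN1r.
exists u; split=> // [x|v r Cvr].
  apply: le_trans (up x) _; have [C0 _ _] := CC.
  by have := cone_inf_le ps Cp x C0; rewrite addr0 subr0.
have := le_trans (up (- v)) (cone_inf_le ps Cp (- v) Cvr).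
by rewrite addNr sublinear0// uN; lra.
Qed.

End HahnBanach.

(** * Day's theorem: invariant states give almost invariant densities *)

Section RealEll1.
Variables (R : realType) (X : choiceType).

(** The scalars are real because linear forms are to be compared with sublinear
    ones. *)
Definition is_rell1 : {pred X -> R^o} := fun f => `[< abs_summable f >].

Lemma is_rell1_submod : submod_closed is_rell1.
Proof.
split=> [|a f g]; rewrite !unfold_in.
  apply/asboolP; rewrite /abs_summable; under eq_fun do rewrite normr0.
  by rewrite nnsum0 ltry.
move=> /asboolP fs /asboolP gs; apply/asboolP.
apply: (abs_summable_dom (normr_ge0 a) ler01 _ fs gs) => x.
by rewrite mul1r -normrM ler_normD.
Qed.

HB.instance Definition _ := GRing.isSubmodClosed.Build R (X -> R^o) is_rell1
  (GRing.submod_closed_semi is_rell1_submod).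

Record rell1 := REll1 { rell1_fun :> X -> R^o; _ : rell1_fun \in is_rell1 }.
HB.instance Definition _ := [isSub for rell1_fun].
HB.instance Definition _ := [Choice of rell1 by <:].
HB.instance Definition _ := [SubChoice_isSubLmodule of rell1 by <:].

Implicit Types f g : rell1.

Lemma rell1_summable f : abs_summable f.
Proof. by apply/asboolP; have := valP f; rewrite unfold_in. Qed.

Definition rnorm1 f : R := fine (nnsum (fun x => `|f x|)).

Lemma rnorm1E f : (rnorm1 f)%:E = nnsum (fun x => `|f x|).
Proof. by rewrite fineK// nnsum_fin//; exact: rell1_summable. Qed.

Lemma rnorm1_sublinear : sublinear rnorm1.
Proof.
split=> [f g|a f a0].
  rewrite -lee_fin EFinD !rnorm1E -nnsumD//.
  by apply: le_nnsum => x; exact: ler_normD.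
apply/EFin_inj; rewrite EFinM !rnorm1E -nnsumZ//.
by apply: eq_esum => x _; rewrite normrM ger0_norm.
Qed.

Lemma rnorm1D f g : (forall x, 0 <= f x) -> (forall x, 0 <= g x) ->
  rnorm1 (f + g) = rnorm1 f + rnorm1 g.
Proof.
move=> f0 g0; apply/EFin_inj; rewrite EFinD !rnorm1E -nnsumD//.
apply: eq_esum => x _; have fg0 : 0 <= f x + g x by exact: addr_ge0.
by rewrite !ger0_norm.
Qed.

Lemma comp_rell1_subproof (s : X -> X) (sI : injective s) f : (f \o s) \in is_rell1.
Proof.
rewrite unfold_in; apply/asboolP; apply: le_lt_trans (rell1_summable f).
exact: (nnsum_comp_le sI (fun x => normr_ge0 (f x))).
Qed.

Definition comp_rell1 s sI f := REll1 (@comp_rell1_subproof s sI f).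

Lemma delta_rell1_subproof (a : X) : (fun x => (x == a)%:R : R^o) \in is_rell1.
Proof.
rewrite unfold_in; apply/asboolP; rewrite /abs_summable.
rewrite (@nnsum_fset _ _ [fset a]%fset) ?ltry// => x.
by rewrite inE => /negPf ->; rewrite normr0.
Qed.

Definition rdelta a := REll1 (delta_rell1_subproof a).

Lemma rnorm1_delta a : rnorm1 (rdelta a) = 1.
Proof.
apply/EFin_inj; rewrite rnorm1E (@nnsum_fset _ _ [fset a]%fset)//=.
  by rewrite big_seq_fset1 eqxx normr1.
by move=> x; rewrite inE => /negPf ->; rewrite normr0.
Qed.

End RealEll1.

Section Day.
Variables (R : realType) (X : choiceType) (I : finType).
Variables (s t : I -> X -> X).
Hypotheses (sK : forall i, cancel (s i) (t i)) (tK : forall i, cancel (t i) (s i)).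

Let sI i : injective (s i) := can_inj (sK i).

Variable phi : {linear ellinf R X -> R[i]}.
Hypothesis phi_state : ellinf_state phi.
Hypothesis phi_inv : forall i f, phi (comp_ellinf (s i) f) = phi f.

(** Invariance gives the total displacement of the [u i] the value 0 under
    [phi], whereas positivity would make this value at least [e]. *)
Lemma no_bounded_gain (u : I -> X -> R) (e : R) : 0 < e ->
    (forall i x, `|u i x| <= 1) ->
  ~ forall x, e <= \sum_i (u i (t i x) - u i x).
Proof.
move=> e0 u1 ue; have [phi0 phi1] := phi_state.
have uP i : (fun x => (u i x)%:C%C) \in @is_ellinf R X.
  by rewrite unfold_in; apply/asboolP; exists 1 => x; rewrite normc_real.
pose F i := EllInf (uP i).
pose W := \sum_i (comp_ellinf (t i) (F i) - F i) - e%:C%C *: one_ellinf R X.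
have phiW : phi W = - e%:C%C.
  rewrite linearB linearZ /= phi1 -[_ *: 1]/(e%:C%C * 1) mulr1 linear_sum.
  rewrite big1 ?sub0r// => i _.
  rewrite linearB /= -(phi_inv i (comp_ellinf _ _)).
  have -> : comp_ellinf (s i) (comp_ellinf (t i) (F i)) = F i; last by rewrite subrr.
  by apply/val_inj/funext => x /=; rewrite sK.
have W_E x : W x = (\sum_i (u i (t i x) - u i x) - e)%:C%C.
  have sumE (r : seq I) : (\sum_(i <- r) (comp_ellinf (t i) (F i) - F i)) x
      = (\sum_(i <- r) (u i (t i x) - u i x))%:C%C.
    elim: r => [|i r IHr]; first by rewrite !big_nil.
    by rewrite !big_cons rcD -IHr /= rmorphB.
  by rewrite /W rmorphB /= -sumE; congr (_ - _); exact: mulr1.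
have : 0 <= phi W by apply: phi0 => x; rewrite W_E ler0c subr_ge0.
by rewrite phiW oppr_ge0 lecR leNgt e0.
Qed.

(** The sums of the displacements [eta o s i - eta] over densities [eta] form a
    convex set; were it bounded away from 0, a bounded functional [u] on the
    sum of copies of [l^1] would separate it from 0. Evaluated at point masses,
    [u] would be a family of bounded functions whose total displacement is
    bounded below, which an invariant state forbids. *)
Lemma invariant_state_density (e : R) : 0 < e ->
  exists eta : X -> R, [/\ forall x, 0 <= eta x, nnsum eta = 1%E &
    forall i, (nnsum (fun x => `|eta (s i x) - eta x|)%R <= e%:E)%E].
Proof.
move=> e0; apply: contrapT => noeta.
pose V := I -> rell1 R X.
pose q (v : V) := \sum_i rnorm1 (v i).
pose D (f : rell1 R X) : V := fun i => comp_rell1 (@sI i) f - f.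
pose C (v : V) r := exists f : rell1 R X,
  [/\ forall x, 0 <= f x, v = D f & r = e * rnorm1 f].
have [n1D n1Z] := @rnorm1_sublinear R X.
have qs : sublinear q.
  split=> [v w|a v a0]; first by rewrite -big_split; apply: ler_sum => i _; exact: n1D.
  by rewrite mulr_sumr; apply: eq_bigr => i _; exact: n1Z.
have CC : convex_cone C.
  split.
  - exists 0; split=> [x||]; first exact: lexx.
      by apply/funext => i; apply/val_inj/funext => x /=; rewrite subr0.
    by rewrite (sublinear0 (@rnorm1_sublinear R X)) mulr0.
  - move=> _ _ _ _ [f [f0 -> ->]] [g [g0 -> ->]]; exists (f + g); split.
    + by move=> x; exact: (addr_ge0 (f0 x) (g0 x)).
    + apply/funext => i; apply/val_inj/funext => x /=.
      by rewrite opprD addrACA.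
    + by rewrite rnorm1D// mulrDr.
  - move=> a _ _ a0 [f [f0 -> ->]]; exists (a *: f); split.
    + by move=> x; exact: (mulr_ge0 a0 (f0 x)).
    + by apply/funext => i; apply/val_inj/funext => x /=; rewrite scalerBr.
    + by rewrite n1Z// mulrCA.
have Cq v r : C v r -> r <= q v.
  move=> [f [f0 -> ->]]; have [fz|fn0] := eqVneq (rnorm1 f) 0.
    by rewrite fz mulr0; apply: sumr_ge0 => i _; rewrite fine_ge0// nnsum_ge0.
  have fpos : 0 < rnorm1 f by rewrite lt_def fn0 fine_ge0// nnsum_ge0.
  set a := rnorm1 f in fpos *; pose g x := a^-1 * f x.
  have a'0 : 0 <= a^-1 by rewrite invr_ge0 ltW.
  rewrite leNgt; apply/negP => small; apply: noeta; exists g; split.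
  - by move=> x; exact: (mulr_ge0 a'0 (f0 x)).
  - rewrite nnsumZ//.
    have -> : nnsum f = a%:E.
      by rewrite /a rnorm1E; apply: eq_esum => x _; rewrite ger0_norm.
    by rewrite -EFinM mulVf.
  - move=> i; have -> : nnsum (fun x => `|g (s i x) - g x|)
        = (a^-1 * rnorm1 (D f i))%:E.
      rewrite EFinM rnorm1E -nnsumZ//; apply: eq_esum => x _.
      by rewrite -mulrBr normrM ger0_norm.
    rewrite lee_fin mulrC ler_pdivrMr//; apply: le_trans (ltW small).
    by rewrite /q (bigD1 i)//= lerDl sumr_ge0// => j _; rewrite fine_ge0// nnsum_ge0.
have [u [[uD uZ] uq uC]] := mazur_orlicz qs CC Cq.
have uN v : u (- v) = - u v by rewrite -scaleN1r uZ mulN1r.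
have u0 : u 0 = 0 by have := uZ 0 0; rewrite scale0r mul0r.
(* the point mass at [a] in the copy of [l^1] of index [i] *)
pose single i a : V := fun j => if j == i then rdelta R a else 0.
have q_single i a : q (single i a) = 1.
  rewrite /q (bigD1 i)//= /single eqxx rnorm1_delta big1 ?addr0// => j /negPf ->.
  exact: (sublinear0 (@rnorm1_sublinear R X)).
have qN v : q (- v) = q v.
  apply: eq_bigr => i _; congr fine; apply: eq_esum => x _.
  by congr EFin; rewrite -normrN opprK.
apply: (@no_bounded_gain (fun i x => u (single i x)) e e0) => [i x|x].
  rewrite ler_norml -(q_single i x) uq andbT -lerN2 opprK -uN -qN.
  exact: uq.
have D_delta : D (rdelta R x) = \sum_i (single i (t i x) - single i x).
  apply/funext => j; rewrite fct_sumE (bigD1 j)//= big1 ?addr0; last first.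
    move=> i /negPf ij; rewrite /single /GRing.add /= /GRing.opp /=.
    by rewrite eq_sym ij oppr0 addr0.
  rewrite -[RHS]/(single j (t j x) j - single j x j) /single eqxx.
  apply/val_inj/funext => y /=; congr (_ - _) => /=.
  by rewrite (can2_eq (sK j) (tK j)).
have : e * rnorm1 (rdelta R x) <= u (D (rdelta R x)).
  by apply: uC; exists (rdelta R x); split=> // y; rewrite ler0n.
rewrite rnorm1_delta mulr1 D_delta.
suff -> : u (\sum_i (single i (t i x) - single i x))
    = \sum_i (u (single i (t i x)) - u (single i x)) by [].
elim/big_ind2: _ => [|v a w b <- <-|i _]; first exact: u0.
- exact: uD.
- by rewrite uD uN.
Qed.

End Day.

(** * Namioka's trick: from almost invariant densities to almost invariant sets *)

Section Indicators.
Variables (R : realType) (X : choiceType).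

Definition indic (A : {fset X}) (x : X) : R := (x \in A)%:R.

Lemma indic_ge0 A x : 0 <= indic A x. Proof. exact: ler0n. Qed.

Lemma indic_out A x : x \notin A -> indic A x = 0.
Proof. by rewrite /indic => /negPf ->. Qed.

Lemma nnsum_indic A : nnsum (indic A) = (#|` A|%:R)%:E.
Proof.
rewrite (nnsum_fset (indic_ge0 A) (@indic_out A)); congr EFin.
rewrite big_seq (eq_bigr (fun=> 1)) => [|x xA]; last by rewrite /indic xA.
by rewrite -big_seq big_const_seq count_predT iter_addr addr0.
Qed.

Lemma sum_indic (A B : {fset X}) : (A `<=` B)%fset ->
  \sum_(x <- B) indic A x = #|` A|%:R.
Proof.
move=> /fsubsetP AB; apply/EFin_inj; rewrite -nnsum_indic.
rewrite (nnsum_fset (A := B) (indic_ge0 A))// => x xB; apply: indic_out.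
by apply: contra xB => /AB.
Qed.

Lemma nnsum_symdiff (A B : {fset X}) :
  nnsum (fun x => `|indic A x - indic B x|) = (#|` fsymdiff A B|%:R)%:E.
Proof.
rewrite -nnsum_indic; apply: eq_esum => x _; congr EFin; rewrite /indic !inE.
by case: (x \in A) (x \in B) => -[];
  rewrite ?subrr ?normr0 ?subr0 ?sub0r ?normrN ?normr1.
Qed.

End Indicators.
Arguments indic R {X} A x.

Section LevelSets.
Variables (R : realType) (X : choiceType) (I : finType) (s : I -> X -> X).
Implicit Types (u : X -> R) (A B F : {fset X}).

Definition displacement B u : R := \sum_i \sum_(x <- B) `|u x - u (s i x)|.

(** Peeling off the bottom layer [c 1_A], with [u] supported in [A] and [c] the
    minimum of [u] on [A], splits every [|u x - u y|] additively. Hence if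
    the layer itself is displaced too much, what remains is displaced too
    little, on a smaller support. *)
Lemma level_set B (e : R) u A : (A `<=` B)%fset -> (forall x, 0 <= u x) ->
    (forall x, x \notin A -> u x = 0) ->
    displacement B u < e * \sum_(x <- B) u x ->
  exists F, [/\ F != fset0, (F `<=` A)%fset &
                displacement B (indic R F) < e * #|` F|%:R].
Proof.
have [n nA] := ubnP #|` A|; elim: n => // n IHn in u A nA * => AB u0 uA small.
have [lt_e|ge_e] := ltP (displacement B (indic R A)) (e * #|` A|%:R).
  exists A; split=> //; apply/eqP => A0; move: lt_e.
  rewrite A0 cardfs0 mulr0 ltNge => /negP; apply.
  by apply: sumr_ge0 => i _; apply: sumr_ge0.
have [A0|[a0 a0A]] := fset_0Vmem A.
  exfalso; have uE x : u x = 0 by apply: uA; rewrite A0 inE.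
  move: small; rewrite [X in e * X]big1// mulr0 ltNge => /negP; apply.
  by apply: sumr_ge0 => i _; apply: sumr_ge0.
have [a _ amin] := @arg_minP _ _ _ [` a0A]%fset xpredT (fun x : A => u (val x)) isT.
set c := u (val a) in amin.
have c_le x : x \in A -> c <= u x by move=> xA; exact: (amin [` xA]%fset).
have c0 : 0 <= c by exact: u0.
pose v x := u x - c * indic R A x.
have vE x : v x = if x \in A then u x - c else u x.
  by rewrite /v /indic; case: ifP => _; rewrite ?mulr1// mulr0 subr0.
have v0 x : 0 <= v x by rewrite vE; case: ifP => // /c_le; rewrite subr_ge0.
have vA x : x \notin (A `\ val a)%fset -> v x = 0.
  rewrite !inE negb_and negbK vE => /orP[/eqP ->|xA].
    by rewrite (valP a) subrr.
  by rewrite (negPf xA) uA.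
have split_dist x y : `|u x - u y|
    = c * `|indic R A x - indic R A y| + `|v x - v y|.
  rewrite !vE /indic; have [xA|xA] := boolP (x \in A);
    have [yA|yA] := boolP (y \in A).
  - by rewrite subrr normr0 mulr0 add0r; congr `|_|; lra.
  - rewrite subr0 normr1 mulr1 (uA y yA) !subr0 !ger0_norm ?subr_ge0 ?c_le//; lra.
  - rewrite sub0r normrN normr1 mulr1 (uA x xA) !sub0r !normrN !ger0_norm
      ?subr_ge0 ?c_le//; lra.
  - by rewrite subrr normr0 mulr0 add0r.
have dE : displacement B u
    = c * displacement B (indic R A) + displacement B v.
  rewrite /displacement mulr_sumr -big_split; apply: eq_bigr => i _ /=.
  by rewrite mulr_sumr -big_split; apply: eq_bigr => x _ /=.
have sE : \sum_(x <- B) u x = c * #|` A|%:R + \sum_(x <- B) v x.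
  rewrite -(sum_indic R AB) mulr_sumr -big_split; apply: eq_bigr => x _ /=.
  by rewrite /v; lra.
have [||//|F [F0 FA Fe]] := IHn v (A `\ val a)%fset _ _ v0 vA.
- by move: nA; rewrite (cardfsD1 (val a)) (valP a).
- by apply: fsubset_trans AB; exact: fsubD1set.
- by move: small; rewrite dE sE mulrDr; have := ler_wpM2l c0 ge_e; lra.
by exists F; split=> //; apply: fsubset_trans FA _; exact: fsubD1set.
Qed.

End LevelSets.

Section AlmostInvariantSets.
Variables (R : realType) (X : choiceType) (I : finType) (s t : I -> X -> X).
Hypothesis sK : forall i, cancel (s i) (t i).

(** A density is cut down to a finite set carrying all but [c] of its mass,
    which adds at most [2 c] to each displacement, before its level sets are
    examined. *)
Lemma density_fset (d e : R) (eta : X -> R) :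
    0 <= d -> 0 < e -> #|I|%:R * d < e ->
    (forall x, 0 <= eta x) -> nnsum eta = 1%E ->
    (forall i, (nnsum (fun x => `|eta (s i x) - eta x|)%R <= d%:E)%E) ->
  exists F : {fset X}, F != fset0 /\
    forall i, (nnsum (fun x => `|indic R F x - indic R F (s i x)|)%R
               <= (e * #|` F|%:R)%:E)%E.
Proof.
move=> d0 e0 de eta0 eta1 etad; set n : R := #|I|%:R in de.
have n0 : 0 <= n by exact: ler0n.
(* small enough for [n * (d + 2 * c) < e * (1 - c)] *)
pose c := (e - n * d) / (2 * n + e + 1).
have den : 0 < 2 * n + e + 1 by lra.
have c0 : 0 < c by rewrite divr_gt0// subr_gt0.
have cE : c * (2 * n + e + 1) = e - n * d by rewrite divfK// gt_eqF.
have [|A] := nnsum_approx eta0 _ c0; rewrite eta1 ?ltry//= => Ac.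
pose u x := eta x * indic R A x.
have u0 x : 0 <= u x by rewrite mulr_ge0// indic_ge0.
have u_eta x : u x <= eta x.
  by rewrite ler_piMr// /indic; case: (x \in A).
have uA x : x \notin A -> u x = 0 by move=> /(indic_out R); rewrite /u => ->; rewrite mulr0.
have sumA : \sum_(x <- A) u x = \sum_(x <- A) eta x.
  rewrite big_seq [RHS]big_seq; apply: eq_bigr => x xA.
  by rewrite /u /indic xA mulr1.
pose r x := eta x - u x.
have r0 x : 0 <= r x by rewrite subr_ge0.
have rc : (nnsum r <= c%:E)%E.
  have : (nnsum (fun x => u x + r x)%R = 1)%E.
    by rewrite -eta1; apply: eq_esum => x _; rewrite /r addrC subrK.
  rewrite nnsumD// (nnsum_fset u0 uA) sumA.
  have rfin : (nnsum r < +oo)%E.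
    apply: (@le_lt_trans _ _ (nnsum eta)); last by rewrite eta1 ltry.
    by apply: le_nnsum => x; rewrite /r gerBl.
  have /fineK <- := nnsum_fin r0 rfin; rewrite -EFinD => -[]; rewrite lee_fin; lra.
(* [B] supports both [u] and all its translates, so sums over [B] are total *)
pose B := (A `|` \bigcup_(i <- enum I) [fset t i x | x in A])%fset.
have AB : (A `<=` B)%fset by exact: fsubsetUl.
have sB i x : s i x \in A -> x \in B.
  move=> sx; rewrite inE; apply/orP; right; apply/bigfcupP; exists i.
    by rewrite mem_enum.
  by apply/imfsetP; exists (s i x) => //=; rewrite sK.
have sumB : \sum_(x <- B) u x = \sum_(x <- A) u x.
  apply/EFin_inj; rewrite -(nnsum_fset u0 uA) -(nnsum_fset u0)// => x xB.
  by apply: uA; apply: contra xB => /(fsubsetP AB).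
have small : displacement s B u < e * \sum_(x <- B) u x.
  apply: (@le_lt_trans _ _ (n * (d + 2 * c))); last first.
    rewrite sumB sumA; have : e * (1 - c) < e * \sum_(x <- A) eta x.
      by rewrite ltr_pM2l.
    by move: cE; lra.
  have -> : n * (d + 2 * c) = \sum_(i : I) (d + 2 * c).
    by rewrite /n mulr_natl sumr_const.
  apply: ler_sum => i _.
  apply: (@le_trans _ _ (\sum_(x <- B) (`|eta (s i x) - eta x| + (r x + r (s i x))))).
    apply: ler_sum => x _.
    have -> : u x - u (s i x) = - (eta (s i x) - eta x) + (- r x + r (s i x)).
      by rewrite /r; lra.
    apply: le_trans (ler_normD _ _) _; rewrite normrN lerD2l.
    by apply: le_trans (ler_normD _ _) _; rewrite normrN !ger0_norm.
  rewrite 2!big_split /=; have -> : d + 2 * c = d + (c + c) by lra.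
  rewrite -lee_fin !EFinD; apply: leeD; last apply: leeD.
  - apply: le_trans (etad i).
    by apply: (@nnsum_ge_fset _ _ B (fun x => `|eta (s i x) - eta x|)) => x.
  - by apply: le_trans rc; exact: (nnsum_ge_fset B r0).
  apply: le_trans rc; apply: le_trans (nnsum_comp_le (can_inj (sK i)) r0).
  by apply: (@nnsum_ge_fset _ _ B (r \o s i)) => x /=.
have [F [F0 FA Fe]] := level_set AB u0 uA small.
exists F; split=> // i; rewrite (nnsum_fset (A := B))//; last first.
  move=> x xB; rewrite !indic_out ?subrr ?normr0//.
    by apply: contra xB => /(fsubsetP FA)/sB.
  by apply: contra xB => /(fsubsetP FA)/(fsubsetP AB).
rewrite lee_fin; apply: le_trans (ltW Fe).
rewrite /displacement (bigD1 i)//= lerDl; apply: sumr_ge0 => j _.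
by apply: sumr_ge0.
Qed.

End AlmostInvariantSets.

(** * Convex combinations of vectors *)

Lemma weighted_sqr_gap (R : realFieldType) (a b p q d : R) :
    0 <= d -> 0 <= p -> 0 <= q -> 0 <= a -> 0 <= b -> a + b <= 1 -> d <= p + q ->
  a * b * d ^+ 2 <= a * p ^+ 2 + b * q ^+ 2.
Proof.
move=> d0 p0 q0 a0 b0 ab dpq.
have d2 : d ^+ 2 <= (p + q) ^+ 2 by rewrite lerXn2r ?nnegrE ?addr_ge0.
have ab0 : 0 <= a * b by exact: mulr_ge0.
apply: le_trans (ler_wpM2l ab0 d2) _.
have s0 : 0 <= a * p ^+ 2 + b * q ^+ 2 by rewrite addr_ge0 ?mulr_ge0 ?sqr_ge0.
have := ler_wpM2r s0 ab; rewrite mul1r; apply: le_trans.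
have := sqr_ge0 (a * p - b * q).
rewrite -subr_ge0 => H; rewrite -subr_ge0; apply: le_trans H _.
by rewrite le_eqVlt; apply/orP; left; apply/eqP; ring.
Qed.

Section Convexity.
Variables (R : realType) (X : choiceType) (J : finType) (w : J -> R).
Hypotheses (w0 : forall j, 0 <= w j) (w1 : \sum_j w j = 1).
Implicit Types xi : J -> ell2 R X.

Let mean xi := \sum_j (w j)%:C%C *: xi j.

(** The variance identity in a Hilbert space. *)
Lemma variance_mean xi : \sum_j w j * norm2 (xi j - mean xi) ^+ 2
  = \sum_j w j * norm2 (xi j) ^+ 2 - norm2 (mean xi) ^+ 2.
Proof.
set mu := mean xi.
have -> : \sum_j w j * norm2 (xi j - mu) ^+ 2 = \sum_j (w j * norm2 (xi j) ^+ 2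
    + (w j * norm2 mu ^+ 2 - 2 * (w j * complex.Re (dotp (xi j) mu)))).
  apply: eq_bigr => j _; rewrite sqr_norm2D norm2N dotpNr.
  by case: (dotp (xi j) mu) => a b /=; lra.
rewrite !big_split /= sumrN -mulr_sumr -mulr_suml w1 mul1r.
suff -> : \sum_j w j * complex.Re (dotp (xi j) mu) = norm2 mu ^+ 2 by lra.
have -> : norm2 mu ^+ 2 = complex.Re (dotp mu mu) by rewrite dotpp.
rewrite {2}/mu /mean.
elim/big_rec2: _ => [|j y z _ ->]; first by rewrite dotp0l.
by rewrite dotp_linl ReD ReM /= mul0r subr0.
Qed.

Lemma norm2_mean_le xi : norm2 (mean xi) ^+ 2 <= \sum_j w j * norm2 (xi j) ^+ 2.
Proof.
by rewrite -subr_ge0 -variance_mean sumr_ge0// => j _; rewrite mulr_ge0 ?sqr_ge0.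
Qed.

(** Uniform convexity, in the form of a lower bound on the variance by the
    distance of two of the values. *)
Lemma norm2_mean_gap xi a b :
  norm2 (mean xi) ^+ 2 + w a * w b * norm2 (xi a - xi b) ^+ 2
  <= \sum_j w j * norm2 (xi j) ^+ 2.
Proof.
have [<-|ab] := eqVneq a b.
  by rewrite subrr norm20 expr0n mulr0 addr0 norm2_mean_le.
rewrite addrC -lerBrDr -variance_mean (bigD1 a)//= (bigD1 b) 1?eq_sym//=.
rewrite addrA; apply: (@le_trans _ _ (w a * norm2 (xi a - mean xi) ^+ 2
    + w b * norm2 (xi b - mean xi) ^+ 2)); last first.
  by rewrite lerDl sumr_ge0// => j _; rewrite mulr_ge0 ?sqr_ge0.
have wab : w a + w b <= 1.
  rewrite -w1 (bigD1 a)//= (bigD1 b) 1?eq_sym//= addrA lerDl.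
  by apply: sumr_ge0.
apply: (weighted_sqr_gap (norm2_ge0 _) (norm2_ge0 _) (norm2_ge0 _) (w0 a) (w0 b) wab).
rewrite (norm2_subC (xi b) (mean xi)); exact: ler_norm2_dist.
Qed.

End Convexity.

(** * The conjugation representation *)

Section Conjugation.
Variables (R : realType) (G : groupType).
Implicit Types (g h x : G) (xi : ell2 R G).

Lemma conj_byK g : cancel (conj_by g) (conj_by g^-1).
Proof. by move=> x; rewrite /conj_by invgK !mulgA mulgV mul1g -mulgA mulgV mulg1. Qed.

Lemma conj_byVK g : cancel (conj_by g^-1) (conj_by g).
Proof. by move=> x; have := conj_byK g^-1%g x; rewrite invgK. Qed.

Lemma conj_by1 x : conj_by 1%g x = x.
Proof. by rewrite /conj_by invg1 mul1g mulg1. Qed.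

Lemma alpha1_id xi : alpha R 1%g xi = xi.
Proof. by apply/val_inj/funext => x /=; rewrite conj_by1. Qed.

Lemma alphaK g xi : alpha R g^-1 (alpha R g xi) = xi.
Proof. by apply/val_inj/funext => x /=; rewrite conj_byVK. Qed.

Lemma alphaVK g xi : alpha R g (alpha R g^-1 xi) = xi.
Proof. by apply/val_inj/funext => x /=; rewrite conj_byK. Qed.

Lemma norm2_alpha g xi : norm2 (alpha R g xi) = norm2 xi.
Proof.
congr (Num.sqrt (fine _)).
exact: (nnsum_bij (fun x => normc (xi x) ^+ 2) (conj_byK g) (conj_byVK g)).
Qed.

Lemma alpha_avgE (F : {fset G}) (f : F -> R) xi :
  alpha_avg f xi = \sum_(g : F) (f g)%:C%C *: alpha R (val g) xi.
Proof. exact: bop_sumE. Qed.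

Definition indic2 (A : {fset G}) : ell2 R G.
Proof.
apply: (@Ell2 _ _ (fun x => (indic R A x)%:C%C)).
rewrite unfold_in (@nnsum_fset _ _ A) ?ltry// => [x|x /(indic_out R) ->].
  exact: sqr_ge0.
by rewrite normc0 expr0n.
Defined.

Lemma indic2E A x : indic2 A x = (indic R A x)%:C%C. Proof. by []. Qed.

Lemma sqr_norm2_indic2 A : norm2 (indic2 A) ^+ 2 = #|` A|%:R.
Proof.
apply/EFin_inj; rewrite sqr_norm2 -nnsum_indic; apply: eq_esum => x _.
rewrite normc_real ger0_norm ?indic_ge0// /indic.
by case: (x \in A); rewrite ?expr1n ?expr0n.
Qed.

Lemma indic_conj h A x : indic R (conj_fset h A) x = indic R A (conj_by h x).
Proof.
rewrite /indic; congr ((nat_of_bool _)%:R); apply/idP/idP => [/imfsetP[y /= yA ->]|hx].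
  by rewrite /conj_by !mulgA mulVg mul1g -mulgA mulVg mulg1.
apply/imfsetP; exists (conj_by h x) => //=.
by rewrite /conj_by !mulgA mulgV mul1g -mulgA mulgV mulg1.
Qed.

Lemma nnsum_conj_symdiff h A :
  nnsum (fun x => `|indic R A x - indic R A (conj_by h x)|)
  = (#|` fsymdiff A (conj_fset h A)|%:R)%:E.
Proof.
rewrite -nnsum_symdiff; apply: eq_esum => x _.
by rewrite indic_conj.
Qed.

Lemma sqr_norm2_alpha_indic2 h A :
  norm2 (indic2 A - alpha R h (indic2 A)) ^+ 2
  = #|` fsymdiff A (conj_fset h A)|%:R.
Proof.
apply/EFin_inj; rewrite sqr_norm2 -nnsum_conj_symdiff; apply: eq_esum => x _.
congr EFin; rewrite ell2_addE ell2_oppE alphaE -/(conj_by h x) !indic2E -rcB.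
rewrite normc_real /indic.
by case: (_ \in A) (_ \in A) => -[];
  rewrite ?subrr ?subr0 ?sub0r ?normrN ?normr1 ?normr0 ?expr1n ?expr0n.
Qed.

Variable H : groupClosed G.

Definition almost_invariant_densities : Prop := approximable
  (fun eta : ell1 R G =>
    [/\ norm1 eta = 1, forall x, 0 <= eta x & forall x, eta x != 0 -> x \notin H])
  (fun h => h \in H) (fun h eta => norm1 (alpha1 h eta - eta)).

Definition almost_invariant_vectors : Prop := approximable
  (fun xi : ell2 R G => norm2 xi = 1 /\ forall x, xi x != 0 -> x \notin H)
  (fun h => h \in H) (fun h xi => norm2 (alpha R h xi - xi)).

Definition almost_invariant_sets : Prop := approximable
  (fun A : {fset G} => A != fset0 /\ forall x, x \in A -> x \notin H)
  (fun h => h \in H)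
  (fun h A => #|` fsymdiff A (conj_fset h A)|%:R / #|` A|%:R : R).

Lemma eprojCE xi x : (1 - eproj R H) xi x = if x \in H then 0 else xi x.
Proof.
rewrite bop_addE bop_oppE ell2_addE ell2_oppE bop_oneE /=.
by case: ifP => _; rewrite ?subrr ?subr0.
Qed.

Lemma eprojC_id xi : (forall x, xi x != 0 -> x \notin H) -> (1 - eproj R H) xi = xi.
Proof.
move=> xiH; apply: ell2_eq => x; rewrite eprojCE; case: ifP => // xH.
by apply/esym/eqP; apply: contraT => /xiH; rewrite xH.
Qed.

Lemma norm2_eprojC xi : norm2 ((1 - eproj R H) xi) <= norm2 xi.
Proof.
rewrite -(@ler_pXn2r _ 2)// ?nnegrE ?norm2_ge0// -lee_fin !sqr_norm2.
apply: le_nnsum => x; rewrite eprojCE; case: ifP => // _.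
by rewrite normc0 expr0n sqr_ge0.
Qed.

(** * The spectrum of averages *)

(** Indicators of almost invariant sets are almost fixed by [alpha f], so a
    bounded inverse of [1 - alpha f (1 - e_H)] would shrink them too much. *)
Lemma spectrum_of_almost_invariant_sets : almost_invariant_sets ->
  forall (F : {fset G}) (f : F -> R),
    (forall g, g \in F -> g \in H) -> (forall g : F, 0 <= f g <= 1) ->
    \sum_(g : F) f g = 1 -> spectrum (alpha_avg f * (1 - eproj R H)) 1.
Proof.
move=> sets F f FH f01 f1 [S [SK _]].
have f0 (g : F) : 0 <= f g by case/andP: (f01 g).
have [M M0 SM] := bop_bounded S.
have e0 : 0 < (M ^+ 2 + 1)^-1 by rewrite invr_gt0 ltr_wpDl ?sqr_ge0.
have [A [A0 AH] Ae] := sets (enum_fset F) _ e0.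
set e := (M ^+ 2 + 1)^-1 in e0 Ae; set xi := indic2 A.
have Apos : 0 < #|` A|%:R :> R by rewrite ltr0n cardfs_gt0.
have xiH x : xi x != 0 -> x \notin H.
  by rewrite /xi /= /indic; case: (boolP (x \in A)) => [/AH//|_]; rewrite eqxx.
have xi_S : S (xi - alpha_avg f xi) = xi.
  have := congr1 (fun T : bop R G => T xi) SK; rewrite !bop_mulE scale1r.
  by rewrite bop_addE bop_oppE bop_mulE bop_oneE eprojC_id.
have avg : xi - alpha_avg f xi
    = \sum_(g : F) (f g)%:C%C *: (xi - alpha R (val g) xi).
  rewrite alpha_avgE; under [RHS]eq_bigr do rewrite scalerBr.
  rewrite sumrB; congr (_ - _); rewrite -scaler_suml.
  suff -> : \sum_(g : F) (f g)%:C%C = 1 :> R[i] by rewrite scale1r.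
  by rewrite -[RHS]/(1%:C%C) -f1; apply/esym; exact: rmorph_sum.
have small : norm2 (xi - alpha_avg f xi) ^+ 2 <= e * #|` A|%:R.
  rewrite avg; apply: le_trans (norm2_mean_le f0 f1 _) _.
  have -> : e * #|` A|%:R = \sum_(g : F) f g * (e * #|` A|%:R).
    by rewrite -mulr_suml f1 mul1r.
  apply: ler_sum => g _.
  rewrite sqr_norm2_alpha_indic2 ler_wpM2l// -ler_pdivrMr//.
  by apply: Ae; [exact: valP | exact: FH (valP g)].
have := SM (xi - alpha_avg f xi); rewrite xi_S => xi_le.
have : #|` A|%:R <= M ^+ 2 * (e * #|` A|%:R).
  rewrite -{1}sqr_norm2_indic2.
  apply: le_trans (_ : (M * norm2 (xi - alpha_avg f xi)) ^+ 2 <= _).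
    by rewrite lerXn2r ?nnegrE ?mulr_ge0 ?norm2_ge0.
  by rewrite exprMn ler_wpM2l ?sqr_ge0.
rewrite mulrA -ler_pdivrMr// divff ?gt_eqF// /e => le1.
have : M ^+ 2 / (M ^+ 2 + 1) < 1 by rewrite ltr_pdivrMr ?mul1r ?ltrDl ?ltr_wpDl ?sqr_ge0.
lra.
Qed.

(** If no unit vector off [H] is almost fixed by [s], averaging uniformly over
    [s] and 1 is a strict contraction off [H], by uniform convexity. *)
Lemma almost_invariant_vectors_of_spectrum :
    (forall (F : {fset G}) (f : F -> R),
      (forall g, g \in F -> g \in H) -> (forall g : F, 0 <= f g <= 1) ->
      \sum_(g : F) f g = 1 -> spectrum (alpha_avg f * (1 - eproj R H)) 1) ->
  almost_invariant_vectors.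
Proof.
move=> spec s e e0; apply: contrapT => noxi.
pose F : {fset G} := (1%g |` [fset h in s | h \in H])%fset.
have FH g : g \in F -> g \in H.
  by rewrite !inE => /orP[/eqP ->|/andP[]//]; exact: gpred1.
have F1 : 1%g \in F by rewrite !inE eqxx.
have Fpos : 0 < #|` F|%:R :> R by rewrite ltr0n cardfs_gt0; apply/fset0Pn; exists 1%g.
pose w : R := #|` F|%:R^-1; pose f (_ : F) := w.
have w0 : 0 < w by rewrite invr_gt0.
have w1 : w <= 1 by rewrite invf_le1// ler1n -(ltr0n R).
have f1 : \sum_(g : F) f g = 1.
  by rewrite sumr_const -cardfE -mulr_natr mulVf// gt_eqF.
have f0 (g : F) : 0 <= f g by exact: ltW.
have f01 (g : F) : 0 <= f g <= 1 by rewrite f0 /f w1.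
apply: (spec F f FH f01 f1); rewrite scale1r.
(* [e] is capped at 1 in order that [1 - k / 2], a bound on [sqrt (1 - k)], be
   nonnegative *)
pose k := (w * Num.min e 1) ^+ 2.
have m0 : 0 < Num.min e 1 by rewrite lt_min e0 ltr01.
have k0 : 0 < k by rewrite exprn_gt0// mulr_gt0.
have k1 : k <= 1.
  by rewrite exprn_ile1 ?mulr_ge0// ?mulr_ile1// ?ge_min ?lexx ?orbT// ltW.
apply: (@neumann_inverse _ _ _ (1 - k / 2)); [lra|lra|] => xi.
rewrite bop_mulE; set zeta := (1 - eproj R H) xi.
have zetaH x : zeta x != 0 -> x \notin H.
  by rewrite eprojCE; case: ifP => //; rewrite eqxx.
apply: (@le_trans _ _ ((1 - k / 2) * norm2 zeta)); last first.
  by rewrite ler_wpM2l ?norm2_eprojC//; lra.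
have [z0|z0] := eqVneq (norm2 zeta) 0.
  by rewrite (norm2_eq0 z0) bop0r norm20 mulr0.
have zpos : 0 < norm2 zeta by rewrite lt_def z0 norm2_ge0.
have [h [hs hH far]] : exists h,
    [/\ h \in s, h \in H & Num.min e 1 * norm2 zeta <= norm2 (zeta - alpha R h zeta)].
  apply: contrapT => noh; apply: noxi.
  pose c : R[i] := ((norm2 zeta)^-1)%:C%C.
  have nc : normc c = (norm2 zeta)^-1.
    by rewrite normc_real ger0_norm// invr_ge0 norm2_ge0.
  exists (c *: zeta); first split.
  - by rewrite norm2Z nc mulVf.
  - move=> x; rewrite ell2_scaleE => cz; apply: zetaH.
    by apply: contraNneq cz => ->; rewrite mulr0.
  - move=> h hs hH; rewrite bopZr -scalerBr norm2Z nc mulrC ler_pdivrMr//.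
    rewrite leNgt; apply/negP => far; apply: noh; exists h; split=> //.
    rewrite norm2_subC; apply: le_trans (ltW far).
    by rewrite ler_wpM2r ?norm2_ge0// ge_min lexx.
have Fh : h \in F by rewrite !inE hs hH orbT.
have := norm2_mean_gap f0 f1 (fun g : F => alpha R (val g) zeta)
  [` F1]%fset [` Fh]%fset.
rewrite -alpha_avgE; cbv beta.
rewrite -[val [` F1]%fset]/(1%g) -[val [` Fh]%fset]/h alpha1_id.
under [X in _ <= X]eq_bigr do rewrite norm2_alpha.
rewrite -mulr_suml f1 mul1r => gap.
have far2 : (Num.min e 1 * norm2 zeta) ^+ 2 <= norm2 (zeta - alpha R h zeta) ^+ 2.
  by rewrite lerXn2r ?nnegrE ?mulr_ge0 ?norm2_ge0 ?(ltW m0).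
rewrite -(@ler_pXn2r _ 2)// ?nnegrE ?mulr_ge0 ?norm2_ge0//; last lra.
have : k * norm2 zeta ^+ 2 <= w * w * norm2 (zeta - alpha R h zeta) ^+ 2.
  have -> : k * norm2 zeta ^+ 2 = w * w * (Num.min e 1 * norm2 zeta) ^+ 2.
    by rewrite /k; ring.
  by rewrite ler_wpM2l// mulr_ge0 ?ltW.
rewrite exprMn; move: gap; rewrite /f.
have := sqr_ge0 (k / 2); have := sqr_ge0 (norm2 zeta).
set z := norm2 zeta ^+ 2; set y := norm2 (alpha_avg _ _) ^+ 2.
set v := w * w * _ => *; nra.
Qed.

End Conjugation.
Arguments almost_invariant_densities R {G} H.
Arguments almost_invariant_vectors R {G} H.
Arguments almost_invariant_sets R {G} H.

(** * From almost invariant vectors to a state extending [tau] *)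

Definition linear_pack (R : pzRingType) (V W : lmodType R) (f : V -> W)
    (fl : linear f) : {linear V -> W} :=
  HB.pack f (GRing.isLinear.Build R V W *:%R f fl).

Section Adjoints.
Variables (R : realType) (X : choiceType).
Implicit Types (S T : bop R X) (f g : ell2 R X).

Lemma is_adjointD S S' T T' : is_adjoint S S' -> is_adjoint T T' ->
  is_adjoint (S + T) (S' + T').
Proof. by move=> SS' TT' f g; rewrite !bop_addE dotpDl dotpDr SS' TT'. Qed.

Lemma is_adjointZ (c : R[i]) T T' : is_adjoint T T' ->
  is_adjoint (c *: T) (c^*%C *: T').
Proof. by move=> TT' f g; rewrite !bop_scaleE dotpZl dotpZr TT' conjcK. Qed.

Lemma is_adjointM S S' T T' : is_adjoint S S' -> is_adjoint T T' ->
  is_adjoint (S * T) (T' * S').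
Proof. by move=> SS' TT' f g; rewrite !bop_mulE SS' TT'. Qed.

Lemma is_adjoint1 : is_adjoint (1 : bop R X) 1.
Proof. by []. Qed.

Lemma is_adjointN T T' : is_adjoint T T' -> is_adjoint (- T) (- T').
Proof. by move=> TT' f g; rewrite !bop_oppE dotpNl dotpNr TT'. Qed.

Lemma is_adjoint_sym T T' : is_adjoint T T' -> is_adjoint T' T.
Proof. by move=> TT' f g; rewrite dotpC -TT' -dotpC. Qed.

Lemma is_adjoint_comp_bop (s t : X -> X) (sI : injective s) (tI : injective t) :
  cancel s t -> cancel t s -> is_adjoint (comp_bop R sI) (comp_bop R tI).
Proof.
move=> sK tK f g; rewrite /dotp.
rewrite -(csum_bij (fun x => f x * (comp_bop R tI g x)^*%C) sK tK).
by congr csum; apply/funext => x /=; rewrite sK.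
Qed.

Lemma norm2_delta (a : X) : norm2 (delta R a) = 1.
Proof.
apply/eqP; rewrite -(@eqrXn2 _ 2) ?norm2_ge0// expr1n; apply/eqP/EFin_inj.
rewrite sqr_norm2 (@nnsum_fset _ _ [fset a]%fset).
- by rewrite big_seq_fset1 /= eqxx normc1 expr1n.
- by move=> x; exact: sqr_ge0.
- by move=> x; rewrite inE /= => /negPf ->; rewrite normc0 expr0n.
Qed.

End Adjoints.

Section AsymptoticEigenvectors.
Variables (R : realType) (G : groupType) (H : groupClosed G).
Implicit Types (S T : bop R G) (xi v : ell2 R G).

Definition almost_fixed (s : seq G) (e : R) : set (ell2 R G) :=
  [set xi | norm2 xi = 1 /\
    forall h, h \in s -> h \in H -> norm2 (alpha R h xi - xi) <= e].

(** No support condition is imposed here, in order that [delta 1], which is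
    fixed by conjugation, belong to every set of the filter: the asymptotic
    eigenvalue of an operator along this filter can only be its value at [tau]. *)
Definition almost_fixed_filter : set_system (ell2 R G) :=
  filter_from [set p : seq G * R | 0 < p.2] (fun p => almost_fixed p.1 p.2).

Local Notation fixF := almost_fixed_filter.

#[local] Instance almost_fixed_filterP : Filter fixF.
Proof.
apply: filter_from_filter; first by exists ([::], 1) => /=.
move=> [s d] [t e] /= d0 e0; exists (s ++ t, Num.min d e) => /=.
  by rewrite lt_min d0.
move=> xi [xi1 xist]; split; split=> // h hs hH;
  apply: le_trans (xist h _ hH) _; rewrite ?mem_cat ?hs ?orbT//.
- by rewrite ge_min lexx.
- by rewrite ge_min lexx orbT.
Qed.

Local Notation d1 := (delta R (1%g : G)).

Lemma alpha_adjoint (g : G) : is_adjoint (alpha R g) (alpha R g^-1).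
Proof. exact: is_adjoint_comp_bop (conj_byK g) (conj_byVK g). Qed.

Lemma alpha_delta1 (g : G) : alpha R g d1 = d1.
Proof.
apply: ell2_eq => x; rewrite alphaE /=; congr (_%:R); congr nat_of_bool.
have e1 : conj_by g 1%g = 1%g by rewrite /conj_by mulg1 mulVg.
rewrite -[in LHS]e1.
exact: (inj_eq (@conj_by_inj _ g)).
Qed.

Lemma near_fixed_unit : \forall xi \near fixF, norm2 xi = 1.
Proof. by exists ([::], 1) => //= xi []. Qed.

Lemma near_fixed_alpha h (e : R) : h \in H -> 0 < e ->
  \forall xi \near fixF, norm2 (alpha R h xi - xi) <= e.
Proof.
by move=> hH e0; exists ([:: h], e) => //= xi [_]; apply=> //; rewrite inE.
Qed.

Lemma near_fixed_delta1 (P : set (ell2 R G)) : (\forall xi \near fixF, P xi) -> P d1.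
Proof.
case=> -[s e] /= e0; apply; split=> [|h _ _]; first exact: norm2_delta.
by rewrite alpha_delta1 subrr norm20 ltW.
Qed.

(** The second clause is the first one for the adjoint of [T], in a form that
    does not presuppose its existence. *)
Definition asymptotic_eigen T : Prop := forall e : R, 0 < e ->
  \forall xi \near fixF, norm2 (T xi - tau T *: xi) <= e /\
    forall v, normc (dotp (T v - tau T *: v) xi) <= e * norm2 v.

Lemma tau_lin (a : R[i]) S T : tau (a *: S + T) = a * tau S + tau T.
Proof. by rewrite /tau bop_addE bop_scaleE dotp_linl. Qed.

Lemma tau_le T : normc (tau T) <= opnorm T.
Proof.
apply: le_trans (cauchy_schwarz _ _) _; rewrite norm2_delta mulr1.
by apply: le_trans (opnorm_bound _ _) _; rewrite norm2_delta mulr1.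
Qed.

Lemma tauB S T : tau (S - T) = tau S - tau T.
Proof. by rewrite /tau bop_addE bop_oppE dotpBl. Qed.

Lemma asymptotic_eigen_delta1 T : asymptotic_eigen T -> T d1 = tau T *: d1.
Proof.
move=> Te; apply/eqP; rewrite -subr_eq0; apply/eqP/norm2_eq0/le_anti.
rewrite norm2_ge0 andbT; apply/ler_addgt0Pl => e e0; rewrite addr0.
by have [] := near_fixed_delta1 (Te e e0).
Qed.

Lemma asymptotic_eigen_alpha h : h \in H -> asymptotic_eigen (alpha R h).
Proof.
move=> hH e e0; have -> : tau (alpha R h) = 1.
  by rewrite /tau alpha_delta1 dotpp norm2_delta expr1n.
apply: filterS (near_fixed_alpha hH e0) => xi xie; rewrite scale1r; split=> // v.
rewrite scale1r dotpBl.
rewrite (alpha_adjoint h) -dotpBr; apply: le_trans (cauchy_schwarz _ _) _.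
rewrite (mulrC e); apply: (ler_wpM2l (norm2_ge0 v)).
rewrite -(norm2_alpha h) bopBr alphaVK norm2_subC; exact: xie.
Qed.

Lemma asymptotic_eigen_lin (a : R[i]) S T :
  asymptotic_eigen S -> asymptotic_eigen T -> asymptotic_eigen (a *: S + T).
Proof.
move=> Se Te e e0; rewrite tau_lin; set s := tau S; set t := tau T.
have a1 : 0 < normc a + 1 by rewrite ltr_wpDl// normc_ge0.
have e'0 : 0 < e / (normc a + 1) by rewrite divr_gt0.
have eE : normc a * (e / (normc a + 1)) + e / (normc a + 1) = e.
  by rewrite -[X in _ + X]mul1r -mulrDl mulrCA mulfV ?mulr1// gt_eqF.
apply: filterS2 (Se _ e'0) (Te _ e'0) => xi [S1 S2] [T1 T2].
have split_v v : (a *: S + T) v - (a * s + t) *: v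
    = a *: (S v - s *: v) + (T v - t *: v).
  by rewrite bop_addE bop_scaleE scalerBr scalerA scalerDl opprD addrACA.
split=> [|v]; rewrite split_v -eE.
  apply: le_trans (ler_norm2D _ _) _; rewrite norm2Z.
  exact: lerD (ler_wpM2l (normc_ge0 a) S1) T1.
rewrite dotp_linl; apply: le_trans (normc_lin _ _ _) _.
rewrite mulrDl -(mulrA (normc a)).
exact: lerD (ler_wpM2l (normc_ge0 a) (S2 v)) (T2 v).
Qed.

Lemma asymptotic_eigen_mul S T :
  asymptotic_eigen S -> asymptotic_eigen T -> asymptotic_eigen (S * T).
Proof.
move=> Se Te e e0.
have -> : tau (S * T) = tau S * tau T.
  rewrite [LHS]/tau bop_mulE (asymptotic_eigen_delta1 Te) bopZr dotpZl.
  exact: (mulrC (tau T) (tau S)).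
set s := tau S; set t := tau T.
have [M M0 SM] := bop_bounded S; have [N N0 TN] := bop_bounded T.
have [s0 t0] := (normc_ge0 s, normc_ge0 t).
pose c := M + N + normc s + normc t + 1.
have c1 : M + normc t <= c by rewrite /c; lra.
have c2 : normc s + N <= c by rewrite /c; lra.
have c0 : 0 < c by rewrite /c; lra.
have e'0 : 0 < e / c by rewrite divr_gt0.
have ecE : e / c * c = e by rewrite divfK// gt_eqF.
apply: filterS2 (Se _ e'0) (Te _ e'0) => xi [S1 S2] [T1 T2]; split=> [|v].
  have -> : (S * T) xi - (s * t) *: xi
      = S (T xi - t *: xi) + t *: (S xi - s *: xi).
    by rewrite bop_mulE bopBr bopZr scalerBr scalerA (mulrC t) addrA subrK.
  apply: le_trans (ler_norm2D _ _) _; rewrite norm2Z.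
  apply: (@le_trans _ _ (M * (e / c) + normc t * (e / c))).
    apply: (fun H => lerD H (ler_wpM2l t0 S1)).
    exact: le_trans (SM _) (ler_wpM2l M0 T1).
  rewrite -mulrDl (mulrC (M + _)).
  by apply: le_trans (ler_wpM2l (ltW e'0) c1) _; rewrite ecE.
have -> : (S * T) v - (s * t) *: v
    = s *: (T v - t *: v) + (S (T v) - s *: T v).
  by rewrite bop_mulE scalerBr scalerA [RHS]addrC subrKA.
rewrite dotp_linl; apply: le_trans (normc_lin _ _ _) _.
have v0 := norm2_ge0 v.
apply: (@le_trans _ _ (normc s * (e / c * norm2 v) + e / c * (N * norm2 v))).
  apply: lerD (ler_wpM2l s0 (T2 v)) _.
  exact: le_trans (S2 _) (ler_wpM2l (ltW e'0) (TN v)).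
rewrite (mulrCA (normc s)) -mulrDr -mulrDl.
apply: le_trans (ler_wpM2l (ltW e'0) (ler_wpM2r v0 c2)) _.
by rewrite mulrA ecE.
Qed.

(** With [t] for [tau T] and [w] for [T' xi - t^* xi], the square norm of [w] is
    [<T w - t w | xi>], which the second clause for [T] bounds by [e |w|]. *)
Lemma asymptotic_eigen_adjoint T T' :
  asymptotic_eigen T -> is_adjoint T T' -> asymptotic_eigen T'.
Proof.
move=> Te TT' e e0; have -> : tau T' = (tau T)^*%C.
  by rewrite /tau TT' dotpC.
set t := tau T; apply: filterS (Te _ e0) => xi [T1 T2]; split=> [|v].
  set w := T' xi - _.
  have ww : norm2 w * norm2 w <= e * norm2 w.
    have /(congr1 (@normc R)) := dotpp w.
    rewrite normc_real ger0_norm ?sqr_ge0// expr2 => <-.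
    rewrite {2}/w dotpBr dotpZr conjcK -TT' -dotpZl -dotpBl; exact: T2.
  have [w0|w0] := eqVneq (norm2 w) 0; first by rewrite w0 ltW.
  have wpos : 0 < norm2 w by rewrite lt_def w0 norm2_ge0.
  by rewrite -(ler_pM2r wpos); exact: ww.
rewrite dotpC normc_conj dotpBr dotpZr conjcK -TT' -dotpZl -dotpBl.
exact: le_trans (cauchy_schwarz _ _) (ler_wpM2r (norm2_ge0 v) T1).
Qed.

Lemma asymptotic_eigen_closed T :
    (forall e : R, 0 < e -> exists2 S, asymptotic_eigen S & opnorm (T - S) < e) ->
  asymptotic_eigen T.
Proof.
move=> Tapprox e e0; have e3 : 0 < e / 3 by rewrite divr_gt0.
have eE : e / 3 + e / 3 + e / 3 = e by lra.
have [S Se TS] := Tapprox _ e3.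
have ts : normc (tau S - tau T) <= e / 3.
  by rewrite -normcN opprB -tauB; apply: le_trans (tau_le _) (ltW TS).
have TSv v : norm2 (T v - S v) <= e / 3 * norm2 v.
  apply: le_trans (opnorm_bound (T - S) v) _.
  by rewrite ler_wpM2r ?norm2_ge0// ltW.
apply: filterS2 (Se _ e3) near_fixed_unit => xi [S1 S2] xi1.
have split_v v : T v - tau T *: v
    = (T v - S v) + (S v - tau S *: v) + (tau S - tau T) *: v.
  by rewrite scalerBl !addrA !subrK.
split=> [|v]; rewrite split_v -eE.
  apply: le_trans (ler_norm2D _ _) (lerD _ _); last first.
    by rewrite norm2Z xi1 mulr1; exact: ts.
  apply: le_trans (ler_norm2D _ _) (lerD _ S1).
  by have := TSv xi; rewrite xi1 mulr1; apply.
rewrite 2!dotpDl !mulrDl; apply: le_trans (le_normcD _ _) (lerD _ _).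
  apply: le_trans (le_normcD _ _) (lerD _ (S2 v)).
  apply: le_trans (cauchy_schwarz _ _) _; rewrite xi1 mulr1; exact: TSv.
rewrite dotpZl normcM; apply: ler_pM (normc_ge0 _) (normc_ge0 _) ts _.
by apply: le_trans (cauchy_schwarz _ _) _; rewrite xi1 mulr1.
Qed.

(** The operators having [tau T] as asymptotic eigenvalue form a C*-algebra, as
    just checked, and this algebra contains [alpha H]. *)
Lemma asymptotic_eigen_Cstar : Cstar_alpha R H `<=` asymptotic_eigen.
Proof.
apply: bigcap_inf; split; last by move=> _ [h hH <-]; exact: asymptotic_eigen_alpha.
split.
- move=> e e0; rewrite /tau dotp0l; apply: filterE => xi.
  rewrite scale0r subr0 norm20; split=> [|v]; first exact: ltW.
  by rewrite scale0r subr0 dotp0l normc0 mulr_ge0 ?norm2_ge0 ?ltW.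
- exact: asymptotic_eigen_lin.
- exact: asymptotic_eigen_mul.
- exact: asymptotic_eigen_adjoint.
- exact: asymptotic_eigen_closed.
Qed.

(** The state is a limit of vector states along almost invariant vectors
    supported off [H]: the support condition kills [e_H], and almost invariance
    makes the limit agree with [tau] on [C*(alpha H)]. *)
Lemma state_of_almost_invariant_vectors : almost_invariant_vectors R H ->
  exists phi : {linear bop R G -> R[i]},
    [/\ bop_state phi, forall T, Cstar_alpha R H T -> phi T = tau T &
        phi (eproj R H) = 0].
Proof.
move=> vecs; pose off : set (ell2 R G) := [set xi | forall x, xi x != 0 -> x \notin H].
pose F0 : set_system (ell2 R G) := filter_from [set p : seq G * R | 0 < p.2]
  (fun p => almost_fixed p.1 p.2 `&` off).
have F0P : ProperFilter F0.
  apply: filter_from_proper => [|[s e] /= e0]; last first.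
    by have [xi [xi1 xiH] xie] := vecs s e e0; exists xi.
  apply: filter_from_filter; first by exists ([::], 1) => /=.
  move=> [s d] [t e] /= d0 e0; exists (s ++ t, Num.min d e) => /=.
    by rewrite lt_min d0.
  move=> xi [[xi1 xist] xiH]; split; split=> //; split=> // h hs hH;
    apply: le_trans (xist h _ hH) _; rewrite ?mem_cat ?hs ?orbT//.
  - by rewrite ge_min lexx.
  - by rewrite ge_min lexx orbT.
have [U [UU F0U]] := ultraFilterLemma F0P.
have fixU (P : set (ell2 R G)) : (\forall xi \near fixF, P xi) -> \forall xi \near U, P xi.
  by case=> p p0 pP; apply: F0U; exists p => // xi [/pP].
have offU : \forall xi \near U, off xi.
  by apply: F0U; exists ([::], 1) => //= xi [].
have unitU := fixU _ near_fixed_unit.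
pose phi T := clim U (fun xi => dotp (T xi) xi).
have phiP T : ccvg U (fun xi => dotp (T xi) xi) (phi T).
  have [M M0 TM] := bop_bounded T; apply: (@ccvg_clim _ _ _ _ _ M).
  apply: filterS unitU => xi xi1; apply: le_trans (cauchy_schwarz _ _) _.
  by have := TM xi; rewrite xi1 !mulr1.
have phi_lin : linear phi.
  move=> a S T; apply: ccvg_unique (phiP _) _.
  apply: (ccvg_near_eq _ (ccvgD (ccvgZ a (phiP S)) (phiP T))).
  by apply: filterE => xi; rewrite bop_addE bop_scaleE dotp_linl.
exists (linear_pack phi_lin); split.
- split=> [T [S [S' [SS' ->]]]|].
    apply: ccvg_ge0 (phiP _); apply: filterE => xi.
    by rewrite bop_mulE dotpC -SS' dotpp conjc_real ler0c sqr_ge0.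
  apply: ccvg_unique (phiP _) _.
  apply: (@ccvg_near_eq _ _ _ _ (fun=> 1)); last exact: ccvg_cst.
  by apply: filterS unitU => xi xi1; rewrite bop_oneE dotpp xi1 expr1n.
- move=> T /asymptotic_eigen_Cstar Te; apply: ccvg_unique (phiP _) _.
  apply: ccvg_small => e e0; apply: filterS2 unitU (fixU _ (Te e e0)) => xi xi1 [T1 _].
  have -> : tau T = dotp (tau T *: xi) xi.
    by rewrite dotpZl dotpp xi1 expr1n mulr1.
  rewrite -dotpBl; apply: le_trans (cauchy_schwarz _ _) _.
  by rewrite xi1 mulr1.
- apply: ccvg_unique (phiP _) _.
  apply: (@ccvg_near_eq _ _ _ _ (fun=> 0)); last exact: ccvg_cst.
  apply: filterS offU => xi xiH.
  suff -> : eproj R H xi = 0 by rewrite dotp0l.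
  apply: ell2_eq => x /=; case: ifP => // xH; apply/eqP; apply: contraT => /xiH.
  by rewrite xH.
Qed.

(** [e_H] fixes [delta 1], so [tau e_H = 1]. *)
Lemma eproj_notin_Cstar (phi : bop R G -> R[i]) :
    (forall T, Cstar_alpha R H T -> phi T = tau T) -> phi (eproj R H) = 0 ->
  ~ Cstar_alpha R H (eproj R H).
Proof.
move=> phi_tau phi0 eC; have := phi_tau _ eC; rewrite phi0 /tau.
have -> : eproj R H d1 = d1.
  by apply: ell2_eq => x /=; case: eqP => [->|]; rewrite ?gpred1//; case: ifP.
by rewrite dotpp norm2_delta expr1n => /eqP; rewrite eq_sym oner_eq0.
Qed.

End AsymptoticEigenvectors.

(** * Restricting a state to multiplication operators *)

Section Multiplication.
Variables (R : realType) (X : choiceType).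
Implicit Types m n : ellinf R X.

Lemma ellinf_bounded m : exists2 M : R, 0 <= M & forall x, normc (m x) <= M.
Proof.
have := valP m; rewrite unfold_in => /asboolP[M mM]; exists `|M| => // x.
exact: le_trans (mM x) (ler_norm M).
Qed.

Lemma mulop_subproof1 m (f : ell2 R X) : (fun x => m x * f x) \in @is_ell2 R X.
Proof.
have [M M0 mM] := ellinf_bounded m; rewrite unfold_in.
apply: (@nnsum_lty _ _ (M ^+ 2) 0 _ _ _ _ _ _ _ _ (ell2_lty f) (ell2_lty f));
  rewrite ?sqr_ge0// => x; rewrite ?sqr_ge0//.
by rewrite mul0r addr0 normcM exprMn ler_wpM2r ?sqr_ge0// lerXn2r ?nnegrE ?normc_ge0.
Qed.

Lemma mulop_subproof2 m : (fun f => Ell2 (mulop_subproof1 m f)) \in @is_bop R X.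
Proof.
have [M M0 mM] := ellinf_bounded m; rewrite unfold_in; apply/asboolP; split.
  move=> a f g; apply/val_inj/funext => x /=.
  by rewrite -[RHS]/(a * (m x * f x) + m x * g x) mulrDr mulrCA.
exists M => f; rewrite -(@ler_pXn2r _ 2)// ?nnegrE ?mulr_ge0 ?norm2_ge0//.
rewrite exprMn -lee_fin (EFinM (M ^+ 2)) !sqr_norm2 -nnsumZ ?sqr_ge0//; last first.
  by move=> x; exact: sqr_ge0.
apply: le_nnsum => x /=; rewrite normcM exprMn ler_wpM2r ?sqr_ge0//.
by rewrite lerXn2r ?nnegrE ?normc_ge0.
Qed.

Definition mulop m : bop R X := Bop (mulop_subproof2 m).

Lemma mulopE m f x : mulop m f x = m x * f x. Proof. by []. Qed.

Lemma mulop_adjoint m n : (forall x, n x = (m x)^*%C) ->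
  is_adjoint (mulop m) (mulop n).
Proof.
move=> nm f g; congr csum; apply/funext => x.
by rewrite !mulopE nm rmorphM /= conjcK mulrCA mulrA.
Qed.

Lemma mulop_positive m : (forall x, 0 <= m x) -> bop_positive (mulop m).
Proof.
move=> m0; have [M M0 mM] := ellinf_bounded m.
have rP : (fun x => (Num.sqrt (complex.Re (m x)))%:C%C) \in @is_ellinf R X.
  rewrite unfold_in; apply/asboolP; exists (Num.sqrt M) => x.
  rewrite normc_real ger0_norm ?sqrtr_ge0// ler_wsqrtr//.
  by apply: le_trans (mM x); apply: le_trans (ler_Re_normc _); exact: ler_norm.
pose r := EllInf rP; exists (mulop r), (mulop r); split.
  by apply: mulop_adjoint => x /=; rewrite oppr0.
apply/val_inj/funext => f; apply/val_inj/funext => x /=; rewrite mulrA -rcM.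
have := m0 x; rewrite lecE => /andP[/eqP im re].
by rewrite -expr2 sqr_sqrtr//; congr (_ * _); apply: complexP.
Qed.

End Multiplication.

Section NullVectors.
Variables (R : realType) (X : choiceType) (phi : {linear bop R X -> R[i]}).
Hypothesis phi_pos : forall T, bop_positive T -> 0 <= phi T.
Implicit Types S T D : bop R X.

Lemma affine_ge0_slope (a c : R[i]) : (forall r : R, 0 <= a + r%:C%C * c) -> c = 0.
Proof.
case: a c => a1 a2 [c1 c2] H.
have Him r : a2 + r * c2 = 0.
  by have := H r; rewrite lecE /= => /andP[/eqP + _]; rewrite mul0r addr0.
have Hre r : 0 <= a1 + r * c1.
  by have := H r; rewrite lecE /= => /andP[_]; rewrite mul0r subr0.
have c20 : c2 = 0 by have := Him 0; have := Him 1; lra.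
have c10 : c1 = 0.
  apply/eqP; apply: contraT => c1n.
  by have := Hre (- (a1 + 1) / c1); rewrite mulrAC -mulrA mulfV// mulr1; lra.
by rewrite c10 c20.
Qed.

(** The Cauchy-Schwarz inequality for the form [(S, T) |-> phi (T^* S)] when one
    of the vectors is null. It is obtained by letting [z] run over the real and
    over the imaginary axis in [phi ((T + z D)^* (T + z D)) >= 0]. *)
Lemma null_orthogonal D D' T T' : is_adjoint D D' -> is_adjoint T T' ->
  phi (D' * D) = 0 -> phi (T' * D) = 0 /\ phi (D' * T) = 0.
Proof.
move=> DD' TT' null.
have expand (z : R[i]) :
    0 <= phi (T' * T) + z * phi (T' * D) + z^*%C * phi (D' * T).
  have -> : phi (T' * T) + z * phi (T' * D) + z^*%C * phi (D' * T)
      = phi ((T' + z^*%C *: D') * (T + z *: D)).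
    have -> : (T' + z^*%C *: D') * (T + z *: D) = T' * T + z *: (T' * D)
        + z^*%C *: (D' * T) + (z^*%C * z) *: (D' * D).
      have scalr c S S1 : S * (c *: S1) = c *: (S * S1).
        by apply: bop_eq => f; rewrite bop_mulE !bop_scaleE bopZr.
      have scall c S S1 : (c *: S) * S1 = c *: (S * S1) by exact: bop_eq.
      by rewrite mulrDl !mulrDr !scall !scalr scalerA !addrA.
    by rewrite !linearD !linearZ /= null scaler0 addr0.
  apply: phi_pos; exists (T + z *: D), (T' + z^*%C *: D'); split=> //.
  exact: is_adjointD TT' (is_adjointZ z DD').
have sum0 : phi (T' * D) + phi (D' * T) = 0.
  apply: (@affine_ge0_slope (phi (T' * T))) => r.
  by have := expand r%:C%C; rewrite conjc_real -addrA -mulrDr.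
have diff0 : 'i%C * (phi (T' * D) - phi (D' * T)) = 0.
  apply: (@affine_ge0_slope (phi (T' * T))) => r.
  have := expand (r%:C%C * 'i%C); rewrite -addrA.
  move: (phi (T' * D)) (phi (D' * T)) => p q.
  suff -> : r%:C%C * 'i%C * p + (r%:C%C * 'i%C)^*%C * q = r%:C%C * ('i%C * (p - q)).
    by [].
  by case: p q => a b [c d]; apply: complexP => /=; ring.
have eqpq : phi (T' * D) = phi (D' * T).
  apply/eqP; rewrite -subr_eq0; move/eqP: diff0; rewrite mulf_eq0 => /orP[|//].
  by rewrite eq_complex /= oner_eq0 andbF.
by move: sum0; rewrite eqpq => /eqP; rewrite -mulr2n mulrn_eq0 => /eqP.
Qed.

End NullVectors.

Section Restriction.
Variables (R : realType) (G : groupType) (H : groupClosed G).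
Local Notation X := (complement H).
Variable phi : {linear bop R G -> R[i]}.
Hypothesis phi_state : bop_state phi.
Hypothesis phi_alpha : forall h, h \in H -> phi (alpha R h) = 1.
Hypothesis phi_e : phi (eproj R H) = 0.

Lemma alphaVM h : alpha R h^-1 * alpha R h = 1 :> bop R G.
Proof. by apply: bop_eq => f; rewrite bop_mulE alphaK. Qed.

(** As [phi (alpha h)] has the largest possible value 1, [alpha h - 1] is null. *)
Lemma alpha_null h : h \in H ->
  phi ((alpha R h^-1 - 1) * (alpha R h - 1)) = 0.
Proof.
move=> hH; have [_ phi1] := phi_state.
rewrite mulrBl mul1r mulrBr mulr1 alphaVM !linearB /= phi1 !phi_alpha ?gpredV//.
by rewrite !subrr addr0.
Qed.

Lemma alphaB1_adjoint (h : G) : is_adjoint (alpha R h - 1) (alpha R h^-1 - 1).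
Proof.
apply: is_adjointD; first exact: alpha_adjoint.
by apply: is_adjointN; exact: is_adjoint1.
Qed.

Lemma state_alphal h T T' : h \in H -> is_adjoint T T' ->
  phi (alpha R h * T) = phi T.
Proof.
move=> hH TT'; have hV : h^-1%g \in H by rewrite gpredV.
have [phi_pos _] := phi_state.
have [_ /eqP] :=
  null_orthogonal phi_pos (alphaB1_adjoint h^-1%g) TT' (alpha_null hV).
by rewrite invgK mulrBl mul1r linearB subr_eq0 => /eqP.
Qed.

Lemma state_alphar h T T' : h \in H -> is_adjoint T T' ->
  phi (T * alpha R h) = phi T.
Proof.
move=> hH TT'; have [phi_pos _] := phi_state.
have [/eqP + _] :=
  null_orthogonal phi_pos (alphaB1_adjoint h) (is_adjoint_sym TT') (alpha_null hH).
by rewrite mulrBr mulr1 linearB subr_eq0 => /eqP.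
Qed.

Definition extend0 (f : X -> R[i]) (x : G) : R[i] :=
  if insub x is Some y then f (y : X) else 0.

Lemma extend0_in f x : x \in H -> extend0 f x = 0.
Proof. by move=> xH; rewrite /extend0 insubN// negbK. Qed.

Lemma extend0_val f (y : X) : extend0 f (val y) = f y.
Proof. by rewrite /extend0 valK. Qed.

Lemma complP x : x \notin H -> exists y : X, x = val y.
Proof. by move=> xH; exists (exist _ x xH). Qed.

Lemma extend0_subproof (f : ellinf R X) : extend0 f \in @is_ellinf R G.
Proof.
have [M M0 fM] := ellinf_bounded f; rewrite unfold_in; apply/asboolP; exists M => x.
have [xH|/complP[y ->]] := boolP (x \in H); first by rewrite extend0_in// normc0.
by rewrite extend0_val.
Qed.

Definition extinf (f : ellinf R X) : ellinf R G := EllInf (extend0_subproof f).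

Definition restr_state (f : ellinf R X) : R[i] := phi (mulop (extinf f)).

Lemma restr_state_linear : linear restr_state.
Proof.
move=> a f g; rewrite /restr_state -linearP; congr (phi _).
apply: bop_eq => xi; apply: ell2_eq => x.
rewrite bop_addE bop_scaleE ell2_addE ell2_scaleE !mulopE /=.
have [xH|/complP[y ->]] := boolP (x \in H).
  by rewrite !extend0_in// !mul0r mulr0 addr0.
by rewrite !extend0_val mulrA -mulrDl.
Qed.

Lemma restr_state_one : restr_state (one_ellinf R X) = 1.
Proof.
have [_ phi1] := phi_state.
rewrite -[RHS]phi1 -[RHS]subr0 -phi_e -linearB; congr (phi _).
apply: bop_eq => xi; apply: ell2_eq => x; rewrite eprojCE mulopE /=.
have [xH|/complP[y ->]] := boolP (x \in H); first by rewrite extend0_in// mul0r.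
by rewrite extend0_val mul1r.
Qed.

Lemma restr_state_pos (f : ellinf R X) : (forall x, 0 <= f x) -> 0 <= restr_state f.
Proof.
move=> f0; have [phi_pos _] := phi_state; apply: phi_pos; apply: mulop_positive => x /=.
have [xH|/complP[y ->]] := boolP (x \in H); first by rewrite extend0_in.
by rewrite extend0_val.
Qed.

Lemma mulop_conj (h : subgroup H) (f : ellinf R X) :
  alpha R (val h) * (mulop (extinf f) * alpha R (val h)^-1)
  = mulop (extinf (comp_ellinf (conj_compl h) f)).
Proof.
apply: bop_eq => xi; apply: ell2_eq => x; rewrite !bop_mulE mulopE.
rewrite -[LHS]/(extend0 f (conj_by (val h) x)
                * alpha R (val h) (alpha R (val h)^-1 xi) x).
rewrite alphaVK; congr (_ * _) => /=.
have [xH|/complP[y ->]] := boolP (x \in H); last first.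
  by rewrite -[conj_by _ _]/(val (conj_compl h y)) !extend0_val.
by rewrite !extend0_in// /conj_by !gpredM ?gpredV ?(valP h).
Qed.

Lemma extinf_adjoint f : exists T', is_adjoint (mulop (extinf f)) T'.
Proof.
have gP : (fun x => (extinf f x)^*%C) \in @is_ellinf R G.
  have [M M0 fM] := ellinf_bounded (extinf f); rewrite unfold_in.
  by apply/asboolP; exists M => x; rewrite normc_conj.
by exists (mulop (EllInf gP)); apply: mulop_adjoint.
Qed.

(** The value of [phi] does not change when its argument is multiplied by
    [alpha h] on either side, hence [phi] is invariant under conjugation. *)
Lemma invariant_state_of_bop_state :
  exists psi : {linear ellinf R X -> R[i]}, invariant_state psi.
Proof.
exists (linear_pack restr_state_linear); split.
  by split; [exact: restr_state_pos | exact: restr_state_one].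
move=> h f; rewrite -[LHS]/(restr_state _) -[RHS]/(restr_state _) /restr_state.
have [T' TT'] := extinf_adjoint f; have hV : (val h)^-1%g \in H by rewrite gpredV (valP h).
have adj := is_adjointM TT' (@alpha_adjoint R G (val h)^-1%g).
rewrite -mulop_conj (state_alphal (valP h) adj); exact: state_alphar hV TT'.
Qed.

End Restriction.

(** * Families indexed by the complement of a subgroup *)

Section OffSubgroup.
Variables (R : realType) (G : groupType) (H : groupClosed G).
Local Notation X := (complement H).

Lemma nnsum_off (u : G -> R) : (forall x, 0 <= u x) ->
  (forall x, x \in H -> u x = 0) -> nnsum u = nnsum (fun y : X => u (val y)).
Proof.
move=> u0 uH; apply/esym; apply: (@nnsum_comp R X G val val_inj u u0) => x ux.
apply: complP; apply/negP => xH.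
by rewrite uH ?eqxx in ux.
Qed.

Lemma conj_by_in (h x : G) : h \in H -> (conj_by h x \in H) = (x \in H).
Proof.
by move=> hH; rewrite /conj_by gpredMr// gpredMl// gpredV.
Qed.

Lemma invariant_state_proper (phi : {linear ellinf R X -> R[i]}) :
  invariant_state phi -> exists g, g \notin H.
Proof.
move=> [[_ phi1] _]; apply: contrapT => noG.
have one0 : one_ellinf R X = 0.
  by apply/val_inj/funext => y; exfalso; apply: noG; exists (val y); exact: valP y.
by move: phi1; rewrite one0 linear0 => /eqP; rewrite eq_sym oner_eq0.
Qed.

Let subH (s : seq G) : seq (subgroup H) := pmap insub s.

Lemma mem_subH (s : seq G) h (hH : h \in H) : h \in s ->
  exists2 k : subgroup H, k \in subH s & val k = h.
Proof.
move=> hs; exists (exist _ h hH) => //; rewrite mem_pmap; apply/mapP.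
by exists h => //; rewrite insubT.
Qed.

Lemma conj_complK (h : subgroup H) : cancel (conj_compl h) (conj_compl h^-1%g).
Proof. by move=> x; apply/val_inj => /=; exact: conj_byK. Qed.

Lemma conj_complVK (h : subgroup H) : cancel (conj_compl h^-1%g) (conj_compl h).
Proof. by move=> x; apply/val_inj => /=; exact: conj_byVK. Qed.

(** * The implications between the conditions *)

Lemma almost_invariant_densities_of_state (phi : {linear ellinf R X -> R[i]}) :
  invariant_state phi -> almost_invariant_densities R H.
Proof.
move=> [phi_st phi_inv] s e e0.
have [u [u0 u1 ue]] := @invariant_state_density R X (seq_sub (subH s))
  (fun h => conj_compl (val h)) (fun h => conj_compl (val h)^-1%g)
  (fun h => conj_complK (val h)) (fun h => conj_complVK (val h))
  phi phi_st (fun h => phi_inv (val h)) e e0.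
pose f x := extend0 (fun y : X => (u y)%:C%C) x.
have nf : nnsum (fun x => normc (f x)) = 1%E.
  rewrite nnsum_off => [|x|x xH]; [|exact: normc_ge0|by rewrite /f extend0_in ?normc0].
  rewrite -u1; apply: eq_esum => y _.
  by rewrite /f extend0_val normc_real ger0_norm.
have fP : f \in @is_ell1 R G by rewrite unfold_in nf ltry.
exists (Ell1 fP); first split.
- by rewrite /norm1 nf.
- move=> x /=; have [xH|/complP[y ->]] := boolP (x \in H).
    by rewrite /f extend0_in.
  by rewrite /f extend0_val ler0c.
- by move=> x /=; apply: contraNN => xH; rewrite /f extend0_in.
move=> h hs hH; have [k ks kh] := mem_subH hH hs.
have /= := ue (SeqSub ks); set n1 := nnsum _ => n1e.
have dE x : (alpha1 h (Ell1 fP) - Ell1 fP) x = f (conj_by h x) - f x by [].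
suff E : nnsum (fun x => normc ((alpha1 h (Ell1 fP) - Ell1 fP) x)) = n1.
  have n1fin : n1 \is a fin_num.
    by apply: nnsum_fin => //; apply: le_lt_trans n1e (ltry e).
  by rewrite /norm1 E -lee_fin fineK.
rewrite nnsum_off => [|x|x xH]; first last.
- rewrite dE /f !extend0_in ?conj_by_in//.
  by rewrite subrr normc0.
- exact: normc_ge0.
apply: eq_esum => y _; congr EFin.
rewrite dE -kh.
rewrite -[conj_by _ _]/(val (conj_compl k y)) /f !extend0_val -rcB.
exact: normc_real.
Qed.

Lemma sqr_dist_sqrt (a b : R) : 0 <= a -> 0 <= b ->
  (Num.sqrt a - Num.sqrt b) ^+ 2 <= `|a - b|.
Proof.
move=> a0 b0; rewrite -{2}(sqr_sqrtr a0) -{2}(sqr_sqrtr b0) subr_sqr normrM expr2.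
have [p0 q0] := (sqrtr_ge0 a, sqrtr_ge0 b).
rewrite -[X in X <= _]ger0_norm -?expr2 ?sqr_ge0// expr2 normrM ler_wpM2l//.
rewrite [X in _ <= X]ger0_norm ?addr_ge0// ler_norml; lra.
Qed.

Lemma almost_invariant_vectors_of_densities :
  almost_invariant_densities R H -> almost_invariant_vectors R H.
Proof.
move=> dens s e e0; have [eta [eta1 eta0 etaH] etae] := dens s _ (exprn_gt0 2 e0).
pose u x := complex.Re (eta x).
have uE x : eta x = (u x)%:C%C.
  by have := eta0 x; rewrite lecE => /andP[/eqP im _]; apply: complexP.
have u0 x : 0 <= u x by have := eta0 x; rewrite uE ler0c.
have norm1E (f : ell1 R G) : nnsum (fun x => normc (f x)) = (norm1 f)%:E.
  rewrite fineK//; apply: nnsum_fin => [x|]; first exact: normc_ge0.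
  by have := valP f; rewrite unfold_in.
have nu : nnsum u = 1%E.
  rewrite -eta1 -norm1E; apply: eq_esum => x _.
  by rewrite uE normc_real ger0_norm.
pose f x : R[i] := (Num.sqrt (u x))%:C%C.
have nf x : normc (f x) ^+ 2 = u x.
  by rewrite normc_real ger0_norm ?sqrtr_ge0// sqr_sqrtr.
have nf1 : nnsum (fun x => normc (f x) ^+ 2) = 1%E.
  by rewrite -nu; apply: eq_esum => x _; rewrite nf.
have fP : f \in @is_ell2 R G by rewrite unfold_in nf1 ltry.
exists (Ell2 fP); first split.
- by rewrite /norm2 nf1 /= sqrtr1.
- move=> x /= fx; apply: etaH; apply: contraNneq fx => ex.
  by rewrite /f /u ex /= sqrtr0.
move=> h hs hH; rewrite -(@ler_pXn2r _ 2)// ?nnegrE ?norm2_ge0 ?(ltW e0)//.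
apply: le_trans (etae h hs hH); rewrite -lee_fin sqr_norm2 -norm1E.
apply: le_nnsum => x.
have -> : (alpha R h (Ell2 fP) - Ell2 fP) x = f (conj_by h x) - f x by [].
have -> : (alpha1 h eta - eta) x = eta (conj_by h x) - eta x by [].
rewrite !uE /f -!rcB !normc_real.
by rewrite real_normK ?num_real// sqr_dist_sqrt.
Qed.

Definition almost_invariant_vectors_compl : Prop := approximable
  (fun zeta : ell2 R X => norm2 zeta = 1) (fun _ : subgroup H => True)
  (fun h zeta => norm2 (pi_compl R H h zeta - zeta)).

Lemma restrict_almost_invariant_vectors :
  almost_invariant_vectors R H -> almost_invariant_vectors_compl.
Proof.
move=> vecs s e e0; have [xi [xi1 xiH] xie] := vecs [seq val h | h <- s] e e0.
have xi_in x : x \in H -> xi x = 0.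
  by move=> xH; apply/eqP; apply: contraT => /xiH; rewrite xH.
have restr : nnsum (fun y : X => normc (xi (val y)) ^+ 2)
    = nnsum (fun x => normc (xi x) ^+ 2).
  rewrite [RHS]nnsum_off// => [x|x xH]; first exact: sqr_ge0.
  by rewrite xi_in// normc0 expr0n.
have zP : (fun y : X => xi (val y)) \in @is_ell2 R X.
  by rewrite unfold_in restr ell2_lty.
exists (Ell2 zP); first by rewrite -xi1 /norm2 restr.
move=> h hs _; have hs' : val h \in [seq val h | h <- s] by exact: map_f.
apply: le_trans (xie _ hs' (valP h)).
rewrite -(@ler_pXn2r _ 2)// ?nnegrE ?norm2_ge0// -lee_fin !sqr_norm2.
rewrite [leRHS]nnsum_off//; first by move=> x; exact: sqr_ge0.
move=> x xH.
have -> : (alpha R (val h) xi - xi) x = xi (conj_by (val h) x) - xi x by [].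
by rewrite !xi_in ?conj_by_in ?(valP h)// subrr normc0 expr0n.
Qed.

(** The left side factors as [||a| - |b|| (|a| + |b|)], and the arithmetic-
    geometric mean inequality with weight [t] separates the two factors. *)
Lemma sqr_normc_dist (a b : R[i]) (t : R) : 0 < t ->
  `|normc a ^+ 2 - normc b ^+ 2|
  <= t^-1 * normc (a - b) ^+ 2 + t * (normc a ^+ 2 + normc b ^+ 2).
Proof.
move=> t0; have ti0 : 0 < t^-1 by rewrite invr_gt0.
have ab : `|normc a - normc b| <= normc (a - b).
  rewrite ler_norml; apply/andP; split.
    have := le_normcD a (b - a); rewrite addrCA subrr addr0.
    by rewrite -(normcN (b - a)) opprB; lra.
  by have := le_normcD (a - b) b; rewrite subrK; lra.
have [a0 b0] := (normc_ge0 a, normc_ge0 b).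
rewrite subr_sqr normrM [X in _ * X]ger0_norm ?addr_ge0//.
apply: le_trans (ler_wpM2r (addr_ge0 a0 b0) ab) _.
move: (normc (a - b)) (normc a) (normc b) (normc_ge0 (a - b)) a0 b0 => d p q d0 p0 q0.
have tt : t^-1 * t = 1 by rewrite mulVf ?gt_eqF.
have : 0 <= t^-1 * (d - t * (p + q) / 2) ^+ 2 by rewrite mulr_ge0 ?sqr_ge0 ?ltW.
have -> : t^-1 * (d - t * (p + q) / 2) ^+ 2
    = t^-1 * d ^+ 2 - (t^-1 * t) * d * (p + q) + (t^-1 * t) * t * (p + q) ^+ 2 / 4.
  by field; rewrite gt_eqF.
have := mulr_ge0 (ltW t0) (sqr_ge0 (p - q)).
have := mulr_ge0 (ltW t0) (addr_ge0 (sqr_ge0 p) (sqr_ge0 q)).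
rewrite tt !mul1r => h1 h2 h3.
have -> : t * (p ^+ 2 + q ^+ 2) = t * (p + q) ^+ 2 / 4 + (t * (p - q) ^+ 2) / 4
    + t * (p ^+ 2 + q ^+ 2) / 2 by field.
lra.
Qed.

(** The square of an almost invariant vector is an almost invariant density, to
    which the level set argument applies. *)
Lemma almost_invariant_sets_of_vectors :
  almost_invariant_vectors_compl -> almost_invariant_sets R H.
Proof.
move=> vecs s e e0; pose I : finType := seq_sub (subH s).
pose d := e / (#|I|%:R + 1).
have n0 : 0 <= #|I|%:R :> R by exact: ler0n.
have n1 : 0 < #|I|%:R + 1 :> R by lra.
have d0 : 0 < d by rewrite divr_gt0.
have de : #|I|%:R * d < e.
  rewrite /d mulrA ltr_pdivrMr//; lra.
(* vectors displaced by at most [t] have squares displaced by at most [3 t] *)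
have t0 : 0 < d / 3 by rewrite divr_gt0.
have [z z1 ze] := vecs (subH s) _ t0; set t := d / 3 in t0 ze.
pose eta (y : X) := normc (z y) ^+ 2.
have eta0 y : 0 <= eta y by exact: sqr_ge0.
have eta1 : nnsum eta = 1%E by rewrite /eta -sqr_norm2 z1 expr1n.
have etad (h : I) :
    (nnsum (fun y => `|eta (conj_compl (val h) y) - eta y|)%R <= d%:E)%E.
  have etah1 : nnsum (fun y => eta (conj_compl (val h) y)) = 1%E.
    by rewrite (nnsum_bij eta (conj_complK _) (conj_complVK _)).
  pose D y := normc (z (conj_compl (val h) y) - z y) ^+ 2.
  have D0 y : 0 <= D y by exact: sqr_ge0.
  have DE : nnsum D = (norm2 (pi_compl R H (val h) z - z) ^+ 2)%:E.
    by rewrite sqr_norm2.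
  have ti0 : 0 <= t^-1 by rewrite invr_ge0 ltW.
  apply: le_trans (_ : nnsum (fun y => t^-1 * D y
      + t * (eta (conj_compl (val h) y) + eta y))%R <= _)%E.
    by apply: le_nnsum => y; exact: sqr_normc_dist.
  rewrite nnsumD => [|y|y]; [|by rewrite mulr_ge0|by rewrite mulr_ge0 ?(ltW t0) ?addr_ge0].
  rewrite !nnsumZ ?(ltW t0)// => [|y]; last by rewrite addr_ge0.
  rewrite nnsumD// eta1 etah1 DE.
  rewrite -[(1 + 1)%E]/((1 + 1)%:E) -[leLHS]/((_ * _ + _ * _)%:E) lee_fin.
  have le_t : norm2 (pi_compl R H (val h) z - z) ^+ 2 <= t ^+ 2.
    rewrite lerXn2r ?nnegrE ?norm2_ge0 ?(ltW t0)//.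
    by apply: ze => //; exact: ssvalP.
  have tt : t^-1 * t ^+ 2 = t by rewrite expr2 mulrA mulVf ?mul1r ?gt_eqF.
  have := ler_wpM2l ti0 le_t; rewrite tt.
  have : d = 3 * t by rewrite /t; lra.
  lra.
have [F [F0 Fe]] := density_fset (fun h : I => conj_complK (val h))
  (ltW d0) e0 de eta0 eta1 etad.
pose A : {fset G} := [fset val y | y in F]%fset.
have cardA : #|` A| = #|` F| by rewrite card_imfset//; exact: val_inj.
have indicA (y : X) : indic R A (val y) = indic R F y.
  by rewrite /indic mem_imfset//; exact: val_inj.
have A_off x : x \in A -> x \notin H by move=> /imfsetP[y /= _ ->]; exact: valP y.
exists A; first split=> //.
  by rewrite -cardfs_gt0 cardA cardfs_gt0.
move=> h hs hH; have [k ks kh] := mem_subH hH hs.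
rewrite ler_pdivrMr; last by rewrite ltr0n cardA cardfs_gt0.
rewrite -lee_fin -nnsum_conj_symdiff cardA; apply: le_trans (Fe (SeqSub ks)).
rewrite nnsum_off// => [|x xH].
  apply: le_nnsum => y /=; rewrite -kh.
  by rewrite -[conj_by _ _]/(val (conj_compl k y)) !indicA.
rewrite !indic_out ?subrr ?normr0//; apply/negP => /A_off; rewrite ?xH//.
by rewrite conj_by_in// xH.
Qed.

Lemma invariant_state_of_tau_state (phi : {linear bop R G -> R[i]}) :
    bop_state phi -> (forall T, Cstar_alpha R H T -> phi T = tau T) ->
    phi (eproj R H) = 0 ->
  exists psi : {linear ellinf R X -> R[i]}, invariant_state psi.
Proof.
move=> phi_st phi_tau phi_e; apply: (@invariant_state_of_bop_state R G H phi) => // h hH.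
rewrite phi_tau; first by rewrite /tau alpha_delta1 dotpp norm2_delta expr1n.
by move=> B [_ BH]; apply: BH; exists h.
Qed.

End OffSubgroup.

Theorem theorem3p1 (R : realType) (G : groupType) (H : groupClosed G) :
  [<-> (* (1) *)
       exists phi : {linear ellinf R (complement H) -> R[i]}, invariant_state phi;
       inner_amenable_relative R H;
       (* (2) *)
       exists (I : Type) (le : I -> I -> Prop) (eta : I -> ell1 R G),
         [/\ directed le,
             forall n, [/\ norm1 (eta n) = 1, forall x, 0 <= eta n x &
                           forall x, eta n x != 0 -> x \notin H] &
             forall h, h \in H ->
               (fun n => norm1 (alpha1 h (eta n) - eta n)) @ tails le --> (0 : R)];
       (* (3) *)
       exists (I : Type) (le : I -> I -> Prop) (xi : I -> ell2 R G),
         [/\ directed le,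
             forall n, norm2 (xi n) = 1 /\
                       forall x, xi n x != 0 -> x \notin H &
             forall h, h \in H ->
               (fun n => norm2 (alpha R h (xi n) - xi n)) @ tails le --> (0 : R)];
       weakly_contains_trivial (pi_compl R H);
       (* (4) *)
       exists (I : Type) (le : I -> I -> Prop) (F : I -> {fset G}),
         [/\ directed le,
             forall n, F n != fset0 /\ forall x, x \in F n -> x \notin H &
             forall h, h \in H ->
               (fun n => #|` fsymdiff (F n) (conj_fset h (F n))|%:R
                         / #|` F n|%:R) @ tails le --> (0 : R)];
       (* (5) *)
       forall (F : {fset G}) (f : F -> R),
         (forall g, g \in F -> g \in H) ->
         (forall g, 0 <= f g <= 1) -> \sum_g f g = 1 ->
         spectrum (alpha_avg f * (1 - eproj R H)) 1;
       (* (6) *)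
       exists phi : {linear bop R G -> R[i]},
         [/\ bop_state phi,
             forall T, Cstar_alpha R H T -> phi T = tau T &
             phi (eproj R H) = 0]]
  /\ (* "in particular" of (6) *)
     ((exists phi : {linear bop R G -> R[i]},
         [/\ bop_state phi,
             forall T, Cstar_alpha R H T -> phi T = tau T &
             phi (eproj R H) = 0]) ->
      ~ Cstar_alpha R H (eproj R H)).
Proof.
have norm1_ge0 (f : ell1 R G) : 0 <= norm1 f.
  by rewrite fine_ge0// nnsum_ge0// => x; exact: normc_ge0.
have ratio_ge0 h (F : {fset G}) :
    0 <= #|` fsymdiff F (conj_fset h F)|%:R / #|` F|%:R :> R.
  by rewrite divr_ge0.
split; last by move=> [phi [_ phi_tau phi_e]]; exact: eproj_notin_Cstar phi_tau phi_e.
tfae.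
- by move=> [phi phi_inv]; split; [exact: invariant_state_proper phi_inv | exists phi].
- move=> [_ [phi phi_inv]].
  exact: (net_of_approximable (almost_invariant_densities_of_state phi_inv)).
- move=> net.
  have dens : almost_invariant_densities R H by exact: approximable_of_net net.
  have vecs := almost_invariant_vectors_of_densities dens.
  exact: (net_of_approximable vecs (fun h xi => norm2_ge0 _)).
- move=> net.
  have vecs : almost_invariant_vectors R H by exact: approximable_of_net net.
  have [I [le [zeta [dir z1 ze]]]] := net_of_approximable
    (restrict_almost_invariant_vectors vecs) (fun h zeta => norm2_ge0 _).
  by exists I, le, zeta; split=> // k; exact: ze.
- move=> [I [le [zeta [dir z1 ze]]]].
  have vecs : almost_invariant_vectors_compl R H.
    by apply: approximable_of_net; exists I, le, zeta; split.
  exact: (net_of_approximable (almost_invariant_sets_of_vectors vecs)).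
- move=> net; apply: spectrum_of_almost_invariant_sets.
  exact: approximable_of_net net.
- move=> spec; apply: state_of_almost_invariant_vectors.
  exact: almost_invariant_vectors_of_spectrum spec.
- move=> [phi [phi_st phi_tau phi_e]].
  exact: invariant_state_of_tau_state phi_st phi_tau phi_e.
Qed.
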